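(* Let $\Omega\subset\mathbb{D}$ be an open set, bounded with respect to the hyperbolic metric $d_h$, let $\tau$ be a nonzero eigenvalue of $\mathcal{L}_h$ on $L^2(\Omega)$, and let $u$ be an associated eigenfunction, extended continuously to all of $\mathbb{D}$ by $$\tau u(z)=\frac12\int_\Omega\log\frac{1}{[z,w]}\,u(w)\,d\mu(w),\qquad z\in\mathbb{D}.$$ Then for each $z\in\mathbb{D}$ and each $0<r<1-|z|$, $$\tau u(z)=\frac{\tau}{2\pi}\int_0^{2\pi}u\bigl(\phi_z(re^{i\theta})\bigr)\,d\theta-\frac12\int_{\Omega\cap\Delta_r(z)}\log\frac{[z,w]}{r}\,u(w)\,d\mu(w).$$ In addition, if $\tau=0$ is an eigenvalue with eigenfunction $u\in L^2(\Omega)$, the representation $$\tau u(z)=\frac{\tau}{2\pi}\int_0^{2\pi}u\bigl(\phi_z(re^{i\theta})\bigr)\,d\theta-\frac12\int_{\Omega\cap\Delta_r(z)}\log\frac{[z,w]}{r}\,u(w)\,d\mu(w)$$ (in which the terms carrying the factor $\tau$ are then zero, so that it reads $0=-\frac12\int_{\Omega\cap\Delta_r(z)}\log\frac{[z,w]}{r}\,u(w)\,d\mu(w)$) remains valid for any $z\in\Omega$ and any $r>0$ such that $\Delta_r(z)\subset\Omega$.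
   Context: $\mathbb{D}=\{z\in\mathbb{C}:|z|<1\}$ is the Poincaré disk; $\phi_z(w)=\frac{z-w}{1-\overline{z}w}$ for $z,w\in\mathbb{D}$; $[z,w]=|\phi_z(w)|$ is the pseudo-hyperbolic distance; $d_h(z,w)=2\tanh^{-1}[z,w]$ is the hyperbolic distance; $\Delta_r(z)=\{w\in\mathbb{D}:[z,w]<r\}$. Let $d\mu(w)=\frac1\pi\frac{dA(w)}{(1-|w|^2)^2}$ with $dA$ the Lebesgue area measure; $L^2(\Omega)$ is the space of (real-valued) functions square integrable on $\Omega$ with respect to $\mu$. The hyperbolic logarithmic potential operator $\mathcal{L}_h:L^2(\Omega)\to L^2(\Omega)$ is $\mathcal{L}_hu(z)=\frac12\int_\Omega\log\frac{1}{[z,w]}\,u(w)\,d\mu(w)$. A number $\tau$ is an eigenvalue with eigenfunction $u$ if $0\ne u\in L^2(\Omega)$ and $\mathcal{L}_hu=\tau u$ in $L^2(\Omega)$. *)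

(* Defs.v *)
From HB Require Import structures.
From mathcomp Require Import all_boot all_order all_algebra.
From mathcomp Require Import complex.
From mathcomp Require Import all_classical all_reals all_analysis.
From mathcomp Require Import measurable_realfun.
Set Implicit Arguments.
Unset Strict Implicit.
Unset Printing Implicit Defensive.
Import Order.TTheory GRing.Theory Num.Theory.
Import numFieldNormedType.Exports.
Local Open Scope classical_set_scope.
Local Open Scope ring_scope.

(* The complex plane is identified with R * R, which carries the product
   topology, the Borel sigma-algebra and the Lebesgue area measure; complex
   arithmetic is done in R[i] through toC and ofC. *)

Section Plane.
Context {R : realType}.

Definition toC (p : R * R) : R[i] := Complex p.1 p.2.

Definition ofC (c : R[i]) : R * R := (complex.Re c, complex.Im c).

Definition cabs (p : R * R) : R := ComplexField.Normc.normc (toC p).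

Definition polar (r theta : R) : R * R := (r * cos theta, r * sin theta).

End Plane.

(* The measurable type on which the library's lebesgue_measure lives, squared;
   its carrier is R * R. *)
Notation plane R := (measurableTypeR R * measurableTypeR R)%type.

Definition area {R : realType} : {measure set (plane R) -> \bar R} :=
  (lebesgue_measure \x lebesgue_measure)%E.

Section Hyperbolic.
Context {R : realType}.

Definition disk : set (R * R) := [set w | cabs w < 1].

Definition phi (z w : R * R) : R * R :=
  ofC ((toC z - toC w) / (1 - conjc (toC z) * toC w)).

Definition pseudo_dist (z w : R * R) : R := cabs (phi z w).

Definition artanh (x : R) : R := ln ((1 + x) / (1 - x)) / 2.

Definition hyp_dist (z w : R * R) : R := 2 * artanh (pseudo_dist z w).

Definition hyp_bounded (Omega : set (R * R)) : Prop :=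
  exists M : R, forall z w, Omega z -> Omega w -> hyp_dist z w <= M.

Definition hyp_disk (r : R) (z : R * R) : set (R * R) :=
  [set w | disk w /\ pseudo_dist z w < r].

Definition hyp_density (w : R * R) : R := pi^-1 * ((1 - cabs w ^+ 2) ^+ 2)^-1.

Definition hyp_measure (A : set (plane R)) : \bar R :=
  (\int[@area R]_(w in A `&` disk) (hyp_density w)%:E)%E.

Lemma cabsE (w : R * R) : cabs w = Num.sqrt (w.1 ^+ 2 + w.2 ^+ 2).
Proof. by []. Qed.

Lemma measurable_cabs : measurable_fun [set: plane R] (@cabs R).
Proof.
have -> : @cabs R = (@powR R)^~ 2^-1 \o (fun w => w.1 ^+ 2 + w.2 ^+ 2).
  by apply/funext => w /=; rewrite powR12_sqrt ?cabsE// addr_ge0 ?sqr_ge0.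
apply: measurableT_comp; first exact: measurable_powR.
by apply: measurable_funD; apply: measurable_funX.
Qed.

Lemma measurable_disk : measurable (disk : set (plane R)).
Proof.
have -> : disk = (@cabs R) @^-1` `]-oo, 1[.
  by apply/seteqP; split=> w; rewrite /disk /= in_itv.
by rewrite -[X in measurable X]setTI; apply: measurable_cabs.
Qed.

Lemma hyp_density_ge0 (w : R * R) : 0 <= hyp_density w.
Proof. by rewrite /hyp_density mulr_ge0// invr_ge0 ?pi_ge0// sqr_ge0. Qed.

Lemma measurable_hyp_density : measurable_fun [set: plane R] hyp_density.
Proof.
apply: measurable_funM => //.
have -> : (fun w => ((1 - @cabs R w ^+ 2) ^+ 2)^-1) =
    (@powR R)^~ (- 1) \o (fun w => (1 - cabs w ^+ 2) ^+ 2).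
  by apply/funext => w /=; rewrite powR_inv1 ?sqr_ge0.
apply: measurableT_comp; first exact: measurable_powR.
apply: measurable_funX; apply: measurable_funB => //.
by apply: measurable_funX; exact: measurable_cabs.
Qed.

Let hyp_measure0 : hyp_measure set0 = 0%E.
Proof. by rewrite /hyp_measure set0I integral_set0. Qed.

Let hyp_measure_ge0 A : (0 <= hyp_measure A)%E.
Proof. by apply: integral_ge0 => w _; rewrite lee_fin hyp_density_ge0. Qed.

Let hyp_measure_sigma_additive : semi_sigma_additive hyp_measure.
Proof.
move=> A mA tA mUA; rewrite /hyp_measure setI_bigcupl.
rewrite ge0_integral_bigcup//=.
- apply: is_cvg_ereal_nneg_natsum_cond => n _ _.
  by apply: integral_ge0 => w _; rewrite lee_fin hyp_density_ge0.
- by move=> k; apply: measurableI => //; exact: measurable_disk.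
- apply: (measurable_funS (E := setT)) => //.
  by apply/measurable_EFinP; exact: measurable_hyp_density.
- by move=> w _; rewrite lee_fin hyp_density_ge0.
- by apply: trivIset_setIr.
Qed.

HB.instance Definition _ := isMeasure.Build _ _ _ hyp_measure
  hyp_measure0 hyp_measure_ge0 hyp_measure_sigma_additive.

End Hyperbolic.

Section Potential.
Context {R : realType}.
Implicit Types (Omega : set (R * R)) (u : R * R -> R) (tau r : R).

(* Representatives of the classes of L^2(Omega). *)
Definition L2 Omega u : Prop :=
  measurable_fun (Omega : set (plane R)) u /\
  (\int[hyp_measure]_(w in Omega) (u w ^+ 2)%:E < +oo)%E.

(* As 0^-1 = 0 and ln 0 = 0, the kernel takes the value 0 instead of +oo on the
   diagonal, which is a null set.  The integral is extended-real valued, so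
   that equating it with a real number includes the absolute convergence. *)
Definition log_potential Omega u (z : R * R) : \bar R :=
  (2^-1%:E *
   \int[hyp_measure]_(w in Omega) (ln (pseudo_dist z w)^-1 * u w)%:E)%E.

Definition eigenfunction Omega tau u : Prop :=
  [/\ L2 Omega u,
      ~ ae_eq hyp_measure Omega u (cst 0) &
      ae_eq hyp_measure Omega (log_potential Omega u)
        (fun z => (tau * u z)%:E)].

(* An equality in \bar R: for tau != 0 it includes the finiteness of both
   integrals; for tau = 0 the circle term is 0 whatever u is on the circle,
   since 0 * x = 0 for every x in \bar R. *)
Definition mean_value_formula Omega tau u (z : R * R) r : Prop :=
  ((tau * u z)%:E =
   (tau / (2 * pi))%:E *
     \int[lebesgue_measure]_(theta in `[0%R, (2 * pi)%R])
        (u (phi z (polar r theta)))%:E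
   - 2^-1%:E *
     \int[hyp_measure]_(w in Omega `&` hyp_disk r z)
        (ln (pseudo_dist z w / r) * u w)%:E)%E.

End Potential.

(* Main.v *)
Require Import Defs.
From HB Require Import structures.
From mathcomp Require Import all_boot all_order all_algebra.
From mathcomp Require Import complex ring lra.
From mathcomp Require Import all_classical all_reals all_analysis.
From mathcomp Require Import measurable_realfun.
Import Order.TTheory GRing.Theory Num.Theory.
Import numFieldNormedType.Exports.
Local Open Scope classical_set_scope.
Local Open Scope ring_scope.
Set Implicit Arguments.
Unset Strict Implicit.
Unset Printing Implicit Defensive.

(* Put [a = z - w] and [b = 1 - conj(z) w].  Moebius invariance turns
   [[phi_z(p), w]], for [p = r e^it], into [|a - p b| / |b - conj(p) a|], so
   Jensen's formula makes the mean over the circle of [log (1 / [., w])] equal to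
   [- log (max [z, w] r)].  By Fubini, the circle mean of the potential of [u] is
   its value at [z] plus the integral of [log ([z, w] / r) u(w)] over
   [Omega `&` hyp_disk r z], which is the theorem for [tau != 0].

   Jensen's formula rests on [|1 - s e^it| |1 + s e^it| = |1 - s^2 e^2it|]: the
   integral [G(s)] of [log |1 - s e^it|] satisfies [G(s^2) = 2 G(s)] and is
   bounded on [|s| <= s0 < 1], hence vanishes.

   The fourth power of the logarithmic kernel has a [mu]-integral over [Omega]
   bounded independently of [z]; this gives the absolute convergence and the
   continuity of the potential.  For [tau = 0] the potential vanishes almost
   everywhere on [Omega], hence everywhere on [Omega] by continuity, and, by
   continuity again, on the circle bounding [hyp_disk r z]. *)

(** * Jensen's formula *)

Section CircleMean.
Context {R : realType}.
Notation leb := (@lebesgue_measure R).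

(** Used with slope 2, for [t -> 2 t], and as the shift by [pi]. *)
Lemma integral_affine (g : R -> R) (k c a b : R) : 0 < k -> a <= b ->
  continuous g ->
  (\int[leb]_(x in `[(k * a + c)%R, (k * b + c)%R]) (g x)%:E =
   \int[leb]_(x in `[a, b]) (g (k * x + c) * k)%:E)%E.
Proof.
move=> k0 ab cg.
have dF (x : R) : is_derive x (1 : R) (fun x : R => k * x + c) k.
  by apply: is_derive_eq; rewrite addr0 scaler1.
have F'E : derive1 (fun x : R => k * x + c) = cst k.
  by apply/funext => x; rewrite derive1E; apply: derive_val.
have cF : continuous (fun x : R => k * x + c).
  by move=> x; apply: differentiable_continuous; apply/derivable1_diffP.
have := @integration_by_substitution_increasing R (fun x => k * x + c) g a b ab.
rewrite F'E => /(_ _ _ _ _ _ _)->//.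
- by move=> x y _ _ xy; rewrite ltrD2r ltr_pM2l.
- by move=> x _; exact: cvg_cst.
- exact: is_cvg_cst.
- exact: is_cvg_cst.
- split.
  + by move=> x _; exact: ex_derive.
  + by apply: cvg_at_right_filter; exact: cF.
  + by apply: cvg_at_left_filter; exact: cF.
- exact: continuous_subspaceT.
Qed.

Lemma lebesgue_measure_0_2pi :
  leb [set` `[0, 2 * pi]] = (2 * pi)%:E.
Proof.
rewrite lebesgue_measure_itv /= lte_fin; case: ltP => [_|p0].
  by rewrite oppr0 adde0.
by congr EFin; apply/le_anti/andP; split=> //; rewrite mulr_ge0// pi_ge0.
Qed.

(** This is [log |1 - z e^it|^2] for [z = x + i y]. *)
Definition log_circle (x y t : R) : R :=
  ln (1 + (x ^+ 2 + y ^+ 2) - 2 * (x * cos t - y * sin t)).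

(** Let [v = x c - y s] and [q = x^2 + y^2]. Cauchy-Schwarz gives [v^2 <= q], so the right-hand side
    is at least [(1 - v)^2], and [v <= (1 + v^2) / 2 <= (1 + q) / 2]. *)
Lemma log_circle_lb (x y c s : R) : c ^+ 2 + s ^+ 2 = 1 -> x ^+ 2 + y ^+ 2 <= 1 ->
  ((1 - (x ^+ 2 + y ^+ 2)) / 2) ^+ 2 <=
  1 + (x ^+ 2 + y ^+ 2) - 2 * (x * c - y * s).
Proof.
move=> cs q1; set v := x * c - y * s; set q := x ^+ 2 + y ^+ 2.
have vq : v ^+ 2 <= q.
  rewrite -subr_ge0 (_ : _ - _ = (x * s + y * c) ^+ 2) ?sqr_ge0//.
  by rewrite /v /q -[x ^+ 2 + y ^+ 2]mulr1 -cs; ring.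
have q0 : 0 <= q by apply: le_trans vq; exact: sqr_ge0.
rewrite -/q in q1.
have v1 : v <= 1 by nra.
suff : ((1 - q) / 2) ^+ 2 <= (1 - v) ^+ 2 by nra.
rewrite ler_sqr ?nnegrE; nra.
Qed.

Lemma log_circle_ub (x y c s : R) : c ^+ 2 + s ^+ 2 = 1 -> x ^+ 2 + y ^+ 2 <= 1 ->
  1 + (x ^+ 2 + y ^+ 2) - 2 * (x * c - y * s) <= 4.
Proof.
move=> cs q1.
have : (x * c - y * s) ^+ 2 <= x ^+ 2 + y ^+ 2.
  rewrite -subr_ge0 (_ : _ - _ = (x * s + y * c) ^+ 2) ?sqr_ge0//.
  by rewrite -[x ^+ 2 + y ^+ 2]mulr1 -cs; ring.
nra.
Qed.

Lemma log_circle_gt0 (x y c s : R) : c ^+ 2 + s ^+ 2 = 1 -> x ^+ 2 + y ^+ 2 < 1 ->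
  0 < 1 + (x ^+ 2 + y ^+ 2) - 2 * (x * c - y * s).
Proof.
move=> cs q1; apply: lt_le_trans (log_circle_lb cs (ltW q1)).
by rewrite exprn_gt0// divr_gt0// subr_gt0.
Qed.

Lemma continuous_log_circle (x y : R) : x ^+ 2 + y ^+ 2 < 1 ->
  continuous (log_circle x y).
Proof.
move=> q1 t; rewrite /log_circle.
apply: (@continuous_comp _ _ _
  (fun t => 1 + (x ^+ 2 + y ^+ 2) - 2 * (x * cos t - y * sin t)) (@ln R)).
  apply: cvgB; first exact: cvg_cst.
  apply: cvgMr; apply: cvgB; apply: cvgMr.
    exact: continuous_cos.
  exact: continuous_sin.
by apply: continuous_ln; apply: log_circle_gt0 => //; exact: cos2Dsin2.
Qed.

Lemma measurable_log_circle (x y : R) (D : set R) : x ^+ 2 + y ^+ 2 < 1 ->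
  measurable_fun D (EFin \o log_circle x y).
Proof.
move=> q1; apply: measurable_funTS; apply/measurable_EFinP.
by apply: continuous_measurable_fun; exact: continuous_log_circle.
Qed.

Definition int_log_circle (x y : R) : R :=
  (\int[leb]_(t in `[0%R, (2 * pi)%R]) log_circle x y t)%R.

Lemma integrable_log_circle (x y a b : R) : x ^+ 2 + y ^+ 2 < 1 ->
  leb.-integrable `[a, b] (EFin \o log_circle x y).
Proof.
move=> q1; apply: continuous_compact_integrable; first exact: segment_compact.
by apply: continuous_subspaceT; exact: continuous_log_circle.
Qed.

(* [|1 - z e^it| |1 + z e^it| = |1 - z^2 e^2it|] *)
Lemma int_log_circle_sqr (x y : R) : x ^+ 2 + y ^+ 2 < 1 ->
  int_log_circle (x ^+ 2 - y ^+ 2) (2 * x * y) = 2 * int_log_circle x y.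
Proof.
move=> q1.
have q0 : 0 <= x ^+ 2 + y ^+ 2 by rewrite addr_ge0 ?sqr_ge0.
have qE : (x ^+ 2 - y ^+ 2) ^+ 2 + (2 * x * y) ^+ 2 = (x ^+ 2 + y ^+ 2) ^+ 2 by ring.
have q2 : (x ^+ 2 - y ^+ 2) ^+ 2 + (2 * x * y) ^+ 2 < 1 by rewrite qE expr_lt1.
have qN : (- x) ^+ 2 + (- y) ^+ 2 < 1 by rewrite !sqrrN.
have pi0 : 0 <= pi :> R := pi_ge0 R.
rewrite /int_log_circle /Rintegral.
(* Halving the angle on the left turns [[0, 2 pi]] into [[0, pi]] and brings the factor 2. The
   integral on the right is then cut at [pi], and its two halves are the two factors of the
   identity. *)
have := @integral_affine (log_circle (x ^+ 2 - y ^+ 2) (2 * x * y)) 2 0 0 pi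
  ltac:(by []) pi0 (continuous_log_circle q2).
rewrite mulr0 !addr0 => ->.
have -> : `[0, 2 * pi]%classic = `[0, pi] `|` `]pi, 2 * pi] :> set R.
  by rewrite -itv_bndbnd_setU// bnd_simp; nra.
rewrite integral_setU//=; last 2 first.
  rewrite -itv_bndbnd_setU// ?bnd_simp; last nra.
  exact: measurable_log_circle.
  apply/disj_setPLR => z /=; rewrite !in_itv/= => /andP[_ zpi].
  by apply/negP; rewrite negb_and -leNgt zpi.
(* The shift by [pi] changes [e^it] into [- e^it], that is, [(x, y)] into [(- x, - y)]. *)
have -> : (\int[leb]_(t in `]pi, (2 * pi)%R]) (log_circle x y t)%:E =
   \int[leb]_(t in `[0%R, pi]) (log_circle (- x) (- y) t)%:E)%E.
  rewrite integral_itv_obnd_cbnd; last first.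
    exact: measurable_log_circle.
  have := @integral_affine (log_circle x y) 1 pi 0 pi ltac:(by []) pi0
    (continuous_log_circle q1).
  rewrite mulr0 add0r mul1r (_ : pi + pi = 2 * pi); last by ring.
  move=> ->.
  apply: eq_integral => t _; rewrite mulr1 mul1r /log_circle.
  by rewrite cosDpi sinDpi !sqrrN !mulrN !mulNr.
have iq := integrable_log_circle 0 pi q1.
have iN := integrable_log_circle 0 pi qN.
rewrite -integralD_EFin//.
have iD : leb.-integrable `[0, pi]
    (fun t => (log_circle x y t + log_circle (- x) (- y) t)%:E).
  by have := integrableD _ iq iN; exact.
transitivity (fine (2%:E * \int[leb]_(t in `[0%R, pi])
    (log_circle x y t + log_circle (- x) (- y) t)%:E)%E).
  rewrite -integralZl//.
  congr fine; apply: eq_integral => t _; rewrite -EFinM mulrC; congr (_ * _)%:E.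
  have cs := cos2Dsin2 t.
  rewrite /log_circle -lnM ?posrE; try exact: log_circle_gt0.
  rewrite qE (_ : 2 * t + 0 = t *+ 2) ; last by rewrite addr0 mulr_natl.
  rewrite cos_mulr2n sin_mulr2n; congr ln.
  apply/eqP; rewrite -subr_eq0 [X in X == _](_ : _ =
    4 * y ^+ 2 * (cos t ^+ 2 + sin t ^+ 2 - 1)); last by ring.
  by rewrite cs subrr mulr0.
rewrite fineM//; exact: integrable_fin_num.
Qed.

(** The integrand lies between [ln (((1 - q) / 2) ^+ 2)] and [ln 4], which depend on [q] alone. *)
Lemma int_log_circle_bound (q : R) : 0 <= q < 1 -> exists B : R,
  forall x y, x ^+ 2 + y ^+ 2 <= q -> `|int_log_circle x y| <= B.
Proof.
move=> /andP[q0 q1].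
pose M : R := - ln (((1 - q) / 2) ^+ 2) + ln 4.
have l4 : 0 <= ln 4 :> R by apply: ln_ge0; lra.
have lq : ln (((1 - q) / 2) ^+ 2) <= 0 by apply: ln_le0; nra.
have M0 : 0 <= M by rewrite /M; lra.
exists (M * (2 * pi)) => x y xyq.
have xy1 : x ^+ 2 + y ^+ 2 < 1 by exact: le_lt_trans q1.
have pi0 : 0 <= 2 * pi :> R by rewrite mulr_ge0// pi_ge0.
apply: le_trans (le_normr_Rintegral _ (integrable_log_circle 0 (2 * pi) xy1)) _ => //.
rewrite /Rintegral -[leRHS]/(fine (M * (2 * pi))%:E) fine_le//.
- apply: integrable_fin_num => //.
  by have := integrable_norm (integrable_log_circle 0 (2 * pi) xy1).
- have := @integral_le_bound _ _ _ leb `[0, 2 * pi] (EFin \o log_circle x y) M%:E.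
  rewrite [X in (M%:E * X)%E](_ : _ = (2 * pi)%:E); last exact: lebesgue_measure_0_2pi.
  rewrite -EFinM; apply => //.
    exact: measurable_log_circle.
  apply: aeW => t _; rewrite lee_fin ler_norml.
  have cs := cos2Dsin2 t.
  have g0 := log_circle_gt0 cs xy1.
  have lb := log_circle_lb cs (ltW xy1).
  have ub := log_circle_ub cs (ltW xy1).
  have L1 : ln (((1 - q) / 2) ^+ 2) <= log_circle x y t.
    rewrite ler_ln ?posrE ?exprn_gt0 ?divr_gt0 ?subr_gt0//.
    by apply: le_trans lb; rewrite ler_sqr ?nnegrE; nra.
    by move: g0; rewrite subr_gt0.
  have L2 : log_circle x y t <= ln 4 by rewrite ler_ln ?posrE.
  by rewrite /M; lra.
Qed.

Lemma int_log_circle0 (x y : R) : x ^+ 2 + y ^+ 2 < 1 -> int_log_circle x y = 0.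
Proof.
move=> q1; set q := x ^+ 2 + y ^+ 2.
have q0 : 0 <= q by rewrite addr_ge0 ?sqr_ge0.
have [B HB] := int_log_circle_bound (introT andP (conj q0 q1)).
(* Squaring the complex number [a + i b] keeps it in the disk [a^2 + b^2 <= q], so each use of the
   functional equation halves the bound there. *)
have H n : forall a b, a ^+ 2 + b ^+ 2 <= q -> `|int_log_circle a b| <= B / 2 ^+ n.
  elim: n => [|n IH] a b abq; first by rewrite expr0 divr1; exact: HB.
  have ab1 : a ^+ 2 + b ^+ 2 < 1 by exact: le_lt_trans q1.
  have := IH (a ^+ 2 - b ^+ 2) (2 * a * b).
  rewrite int_log_circle_sqr// normrM ger0_norm// => IHab.
  have -> : B / 2 ^+ n.+1 = (B / 2 ^+ n) / 2.
    by rewrite exprS; field; rewrite expf_neq0.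
  rewrite ler_pdivlMr// mulrC; apply: IHab.
  have a0 : 0 <= a ^+ 2 + b ^+ 2 by rewrite addr_ge0 ?sqr_ge0.
  rewrite (_ : _ + _ = (a ^+ 2 + b ^+ 2) ^+ 2); last by ring.
  nra.
apply/eqP; rewrite -normr_le0; apply/ler_addgt0Pr => e e0; rewrite add0r.
have B0 : 0 <= B by apply: le_trans (HB x y (lexx _)).
have [n nB] : exists n : nat, B / e < n%:R.
  by exists (Num.bound (B / e)); apply: archi_boundP; rewrite divr_ge0// ltW.
apply: le_trans (H n x y (lexx _)) _.
rewrite ler_pdivrMr ?exprn_gt0// mulrC -ler_pdivrMr//.
apply: le_trans (ltW nB) _; rewrite -natrX ler_nat; exact/ltnW/ltn_expl.
Qed.


(** With [p = |a|^2], [q = |b|^2] and [m + n i = conj(a) b], the quantity is [|a - b e^it|^2], which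
    can vanish only if [|a| = |b|]. Dividing by the larger of [p] and [q] reduces the claim to
    [log_circle_gt0]. *)
Lemma ln_circle_gt0 (p q m n c s : R) : c ^+ 2 + s ^+ 2 = 1 ->
  0 <= p -> 0 <= q -> p != q -> m ^+ 2 + n ^+ 2 = p * q ->
  0 < p + q - 2 * (m * c - n * s).
Proof.
wlog pq : p q / q < p => [H cs p0 q0 pq mn|].
  have [?|?|E] := ltgtP q p.
  - exact: H.
  - by rewrite (addrC p); apply: H; rewrite // 1?eq_sym// mulrC.
  - by rewrite E eqxx in pq.
move=> cs p0 q0 _ mn.
have {}p0 : 0 < p by exact: le_lt_trans pq.
have xy : (m / p) ^+ 2 + (n / p) ^+ 2 = q / p.
  by rewrite !expr_div_n -mulrDl mn; field; rewrite gt_eqF.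
have xy1 : (m / p) ^+ 2 + (n / p) ^+ 2 < 1 by rewrite xy ltr_pdivrMr// mul1r.
have := log_circle_gt0 cs xy1.
rewrite xy -(pmulr_rgt0 _ p0).
by congr (_ < _); field; rewrite gt_eqF.
Qed.

(* Jensen's formula for [z |-> |a - b z|^2], with [p = |a|^2], [q = |b|^2] and
   [m + n i = a^* b]. *)
Lemma integral_ln_circle (p q m n : R) :
  0 <= p -> 0 <= q -> p != q -> m ^+ 2 + n ^+ 2 = p * q ->
  leb.-integrable `[0, 2 * pi]
    (fun t => (ln (p + q - 2 * (m * cos t - n * sin t)))%:E) /\
  (\int[leb]_(t in `[0%R, (2 * pi)%R])
     (ln (p + q - 2 * (m * cos t - n * sin t)))%:E =
   (2 * pi * ln (Num.max p q))%:E)%E.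
Proof.
wlog pq : p q / q < p => [H p0 q0 pq mn|].
  have [h|h|E] := ltgtP q p.
  - by have := H p q; rewrite (max_l (ltW h)); apply.
  - rewrite (addrC p); have := H q p; rewrite (max_l (ltW h)); apply=> //.
      by rewrite eq_sym.
    by rewrite mulrC.
  - by rewrite E eqxx in pq.
move=> p0 q0 _ mn; rewrite (max_l (ltW pq)).
have {}p0 : 0 < p by exact: le_lt_trans pq.
have xy : (m / p) ^+ 2 + (n / p) ^+ 2 = q / p.
  by rewrite !expr_div_n -mulrDl mn; field; rewrite gt_eqF.
have xy1 : (m / p) ^+ 2 + (n / p) ^+ 2 < 1 by rewrite xy ltr_pdivrMr// mul1r.
have -> : (fun t => (ln (p + q - 2 * (m * cos t - n * sin t)))%:E) =
    (fun t => (ln p + log_circle (m / p) (n / p) t)%:E).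
  apply/funext => t; congr EFin; rewrite /log_circle -lnM ?posrE//; last first.
    by apply: log_circle_gt0 => //; exact: cos2Dsin2.
  by congr ln; rewrite xy; field; rewrite gt_eqF.
have i1 : leb.-integrable `[0, 2 * pi] (EFin \o (cst (ln p))).
  apply: continuous_compact_integrable; first exact: segment_compact.
  by apply: continuous_subspaceT => ?; exact: cvg_cst.
have i2 := integrable_log_circle 0 (2 * pi) xy1.
split; first by have := integrableD _ i1 i2; exact.
have := integralD_EFin _ i1 i2 => /= ->//.
rewrite [X in (X + _)%E](_ : _ = (2 * pi * ln p)%:E); last first.
  rewrite integral_cst// [X in (_ * X)%E](_ : _ = (2 * pi)%:E).
    by rewrite -EFinM mulrC.
  exact: lebesgue_measure_0_2pi.
rewrite -[X in (_ + X)%E]fineK; last exact: integrable_fin_num.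
have := int_log_circle0 xy1; rewrite /int_log_circle /Rintegral => ->.
by rewrite adde0.
Qed.
End CircleMean.

(** * The pseudo-hyperbolic distance *)

Section PseudoDistance.
Context {R : realType}.
Implicit Types z w : R * R.

(* [|z - w|^2] and [|1 - conj(z) w|^2] *)
Definition num_sq z w : R := (z.1 - w.1) ^+ 2 + (z.2 - w.2) ^+ 2.
Definition den_sq z w : R :=
  (1 - (z.1 * w.1 + z.2 * w.2)) ^+ 2 + (z.1 * w.2 - z.2 * w.1) ^+ 2.

Definition sqnorm z : R := z.1 ^+ 2 + z.2 ^+ 2.

Lemma sqnorm_ge0 z : 0 <= sqnorm z.
Proof. by rewrite addr_ge0// sqr_ge0. Qed.

Lemma cabs_sqr z : cabs z ^+ 2 = sqnorm z.
Proof. by rewrite cabsE sqr_sqrtr// sqnorm_ge0. Qed.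

Lemma diskE z : disk z <-> sqnorm z < 1.
Proof.
rewrite -cabs_sqr /disk/= expr_lt1//.
by rewrite cabsE sqrtr_ge0.
Qed.

Lemma num_sq_ge0 z w : 0 <= num_sq z w.
Proof. by rewrite addr_ge0// sqr_ge0. Qed.

Lemma den_sq_ge0 z w : 0 <= den_sq z w.
Proof. by rewrite addr_ge0// sqr_ge0. Qed.

(** This identity is the source of [[z, w] < 1], and it also converts a bound on [[z, w]] into a
    distance to the unit circle in [hyp_bounded_sqnorm]. *)
Lemma den_sq_num_sq z w :
  den_sq z w = num_sq z w + (1 - sqnorm z) * (1 - sqnorm w).
Proof. by rewrite /den_sq /num_sq /sqnorm; ring. Qed.

Lemma num_sq_lt_den_sq z w : disk z -> disk w -> num_sq z w < den_sq z w.
Proof.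
by move=> /diskE z1 /diskE w1; rewrite den_sq_num_sq ltrDl mulr_gt0// subr_gt0.
Qed.

Lemma den_sq_gt0 z w : disk z -> disk w -> 0 < den_sq z w.
Proof.
by move=> z1 w1; apply: le_lt_trans (num_sq_lt_den_sq z1 w1); exact: num_sq_ge0.
Qed.

Lemma normc_sub z w : ComplexField.Normc.normc (toC z - toC w) = Num.sqrt (num_sq z w).
Proof. by []. Qed.

Lemma normc_den z w :
  ComplexField.Normc.normc (1 - conjc (toC z) * toC w) = Num.sqrt (den_sq z w).
Proof. by rewrite /= /den_sq; congr Num.sqrt; ring. Qed.

Lemma toCK : cancel (@ofC R) toC. Proof. by case. Qed.

Lemma pseudo_distE z w : pseudo_dist z w = Num.sqrt (num_sq z w / den_sq z w).
Proof.
rewrite /pseudo_dist /phi /cabs toCK ComplexField.Normc.normcM ComplexField.Normc.normcV.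
by rewrite normc_sub normc_den sqrtrM ?num_sq_ge0// sqrtrV// den_sq_ge0.
Qed.

Lemma pseudo_dist_ge0 z w : 0 <= pseudo_dist z w.
Proof. by rewrite pseudo_distE sqrtr_ge0. Qed.

Lemma pseudo_dist_sqr z w : pseudo_dist z w ^+ 2 = num_sq z w / den_sq z w.
Proof. by rewrite pseudo_distE sqr_sqrtr// divr_ge0 ?num_sq_ge0 ?den_sq_ge0. Qed.

Lemma pseudo_dist_lt1 z w : disk z -> disk w -> pseudo_dist z w < 1.
Proof.
move=> z1 w1; rewrite -(@expr_lt1 _ 2)// ?pseudo_dist_ge0// pseudo_dist_sqr.
by rewrite ltr_pdivrMr ?den_sq_gt0// mul1r num_sq_lt_den_sq.
Qed.

Lemma ln_sqrtr (x : R) : 0 <= x -> ln (Num.sqrt x) = ln x / 2.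
Proof.
rewrite le_eqVlt => /predU1P[<-|x0]; first by rewrite sqrtr0 ln0// mul0r.
rewrite -[in RHS](sqr_sqrtr (ltW x0)) lnXn ?sqrtr_gt0//.
by rewrite mulr2n; lra.
Qed.

Lemma ln_invr (x : R) : 0 <= x -> ln x^-1 = - ln x.
Proof.
rewrite le_eqVlt => /predU1P[<-|x0]; first by rewrite invr0 ln0// oppr0.
by rewrite lnV// posrE.
Qed.

(** It holds on the diagonal too, where both sides are 0 because [0^-1 = 0] and [ln 0 = 0]. *)
Lemma ln_pseudo_distV z w :
  ln (pseudo_dist z w)^-1 = - ln (num_sq z w / den_sq z w) / 2.
Proof.
rewrite ln_invr ?pseudo_dist_ge0// pseudo_distE ln_sqrtr ?mulNr//.
by rewrite divr_ge0 ?num_sq_ge0 ?den_sq_ge0.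
Qed.

(** [cross_re] and [cross_im] are the real and imaginary parts of [conj(a) b], where [a = z - w] and
    [b = 1 - conj(z) w]. *)
Definition cross_re z w : R :=
  (z.1 - w.1) * (1 - (z.1 * w.1 + z.2 * w.2)) - (z.2 - w.2) * (z.1 * w.2 - z.2 * w.1).
Definition cross_im z w : R :=
  - ((z.1 - w.1) * (z.1 * w.2 - z.2 * w.1)) - (z.2 - w.2) * (1 - (z.1 * w.1 + z.2 * w.2)).

Lemma cross_sqr z w : cross_re z w ^+ 2 + cross_im z w ^+ 2 = num_sq z w * den_sq z w.
Proof. by rewrite /cross_re /cross_im /num_sq /den_sq; ring. Qed.

Lemma disk_polar r t : 0 <= r < 1 -> disk (polar r t : R * R).
Proof.
move=> /andP[r0 r1]; apply/diskE.
rewrite /sqnorm /= (_ : _ + _ = r ^+ 2 * (cos t ^+ 2 + sin t ^+ 2)); last by ring.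
by rewrite cos2Dsin2 mulr1 expr_lt1.
Qed.

(* With [a = z - w], [b = 1 - conj(z) w] and [p = r e^it], one has
   [phi_z(p) - w = (a - p b) / (1 - conj(z) p)] and
   [1 - conj(phi_z(p)) w = (b - conj(p) a) / (1 - z conj(p))]. *)
Lemma pseudo_dist_phi_polar z w r t : disk z -> 0 <= r < 1 ->
  pseudo_dist (phi z (polar r t)) w = Num.sqrt (
   (num_sq z w + r ^+ 2 * den_sq z w -
      2 * (r * cross_re z w * cos t - r * cross_im z w * sin t)) /
   (den_sq z w + r ^+ 2 * num_sq z w -
      2 * (r * cross_re z w * cos t - r * cross_im z w * sin t))).
Proof.
move=> z1 /andP[r0 r1]; set p := polar r t.
have cs := cos2Dsin2 t.
have p1 : disk p by apply: disk_polar; rewrite r0.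
have D0 : 1 - conjc (toC z) * toC p != 0.
  apply/negP => /eqP/(congr1 (@ComplexField.Normc.normc R)).
  rewrite normc_den ComplexField.Normc.normc0 => /eqP.
  by rewrite sqrtr_eq0 leNgt den_sq_gt0.
(* The two denominators are conjugate to each other, so their moduli cancel in the quotient. *)
have nD : ComplexField.Normc.normc (1 - conjc (toC z) * toC p) =
          ComplexField.Normc.normc (1 - toC z * conjc (toC p)).
  by rewrite /=; congr Num.sqrt; ring.
have nD0 : ComplexField.Normc.normc (1 - conjc (toC z) * toC p) != 0.
  by rewrite normc_den sqrtr_eq0 -ltNge den_sq_gt0.
have D0' : 1 - toC z * conjc (toC p) != 0.
  by apply: contra_neq nD0 => E; rewrite nD E ComplexField.Normc.normc0.
pose a := (toC z - toC p) / (1 - conjc (toC z) * toC p).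
pose A := toC z - toC w; pose B := 1 - conjc (toC z) * toC w.
have Ea : a - toC w = (A - toC p * B) / (1 - conjc (toC z) * toC p).
  by rewrite /a /A /B; field.
have ca : conjc a = (conjc (toC z) - conjc (toC p)) / (1 - toC z * conjc (toC p)).
  apply: (mulIf D0'); rewrite divfK// -[RHS](rmorphB (@conjc R)).
  have <- : a * (1 - conjc (toC z) * toC p) = toC z - toC p by rewrite divfK.
  have -> : 1 - toC z * conjc (toC p) = conjc (1 - conjc (toC z) * toC p).
    by rewrite /=; congr Complex; ring.
  by rewrite [RHS](rmorphM (@conjc R)).
have Eb : 1 - conjc a * toC w = (B - conjc (toC p) * A) / (1 - toC z * conjc (toC p)).
  by rewrite ca /A /B; field.
rewrite /pseudo_dist {1}/phi /cabs toCK [phi z p]/phi toCK -/a Ea Eb.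
rewrite !(ComplexField.Normc.normcM, ComplexField.Normc.normcV) -nD invfM invrK mulrACA.
rewrite mulVf// mulr1.
(* Inserting [cos^2 + sin^2 = 1] through [r^2] makes both remaining equalities polynomial
   identities. *)
have r2 : r ^+ 2 = r ^+ 2 * (cos t ^+ 2 + sin t ^+ 2) by rewrite cs mulr1.
have normcE (c : R[i]) : ComplexField.Normc.normc c =
    Num.sqrt (complex.Re c ^+ 2 + complex.Im c ^+ 2) by case: c.
rewrite !normcE -sqrtrV ?addr_ge0 ?sqr_ge0// -sqrtrM ?addr_ge0 ?sqr_ge0//=.
congr (Num.sqrt (_ / _)).
  rewrite [X in _ + X * den_sq z w]r2.
  by rewrite /num_sq /den_sq /cross_re /cross_im; ring.
rewrite [X in _ + X * num_sq z w]r2.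
by rewrite /num_sq /den_sq /cross_re /cross_im; ring.
Qed.

(** This is [a / b = conj(conj(a) b) / |b|^2]. *)
Lemma phiE z w : disk z -> disk w ->
  phi z w = (cross_re z w / den_sq z w, - cross_im z w / den_sq z w).
Proof.
move=> z1 w1; have := den_sq_gt0 z1 w1; rewrite lt0r => /andP[D0 _].
rewrite /phi /ofC /=.
have -> : (0 - (z.1 * w.2 + - z.2 * w.1)) ^+ 2 =
  (z.1 * w.2 - z.2 * w.1) ^+ 2 by ring.
have -> : (1 - (z.1 * w.1 - - z.2 * w.2)) = (1 - (z.1 * w.1 + z.2 * w.2)) by ring.
by congr pair; rewrite /cross_re /cross_im -/(den_sq z w); field.
Qed.

Lemma disk_phi z w : disk z -> disk w -> disk (phi z w).
Proof.
move=> z1 w1; rewrite /disk /=; exact: pseudo_dist_lt1.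
Qed.

Lemma disk_coord z : disk z -> `|z.1| <= 1 /\ `|z.2| <= 1.
Proof.
move=> /diskE; rewrite /sqnorm => z1; split;
  by rewrite -(@expr_le1 _ 2)// real_normK ?num_real//; nra.
Qed.

(** The norm of [R * R] is the maximum norm, which is at most the Euclidean one. *)
Lemma num_sq_ge_norm z w : `|z - w| <= Num.sqrt (num_sq z w).
Proof.
rewrite prod_normE /= ge_max /num_sq -!sqrtr_sqr !ler_wsqrtr//= ?lerDl ?lerDr ?sqr_ge0//.
Qed.

Lemma num_sq_eq0 z w : (num_sq z w == 0) = (z == w).
Proof.
rewrite /num_sq paddr_eq0 ?sqr_ge0// !sqrf_eq0 !subr_eq0.
by case: z w => [a b] [c d]; rewrite xpair_eqE.
Qed.

(** [|1 - conj(z) w|] is at least [1 - Re (conj(z) w)], and Cauchy-Schwarz bounds this real part by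
    [sqrt (1 - c) <= 1 - c / 2]. The bound is uniform in [z], up to the unit circle. *)
Lemma den_sq_lb z w (c : R) : disk z -> 0 <= c -> sqnorm w <= 1 - c ->
  (c / 2) ^+ 2 <= den_sq z w.
Proof.
move=> /diskE z1 c0 wc.
have CS : (z.1 * w.1 + z.2 * w.2) ^+ 2 <= sqnorm z * sqnorm w.
  rewrite -subr_ge0 (_ : _ - _ = (z.1 * w.2 - z.2 * w.1) ^+ 2) ?sqr_ge0//.
  by rewrite /sqnorm; ring.
have w0 := sqnorm_ge0 w; have z0 := sqnorm_ge0 z.
have {}CS : (z.1 * w.1 + z.2 * w.2) ^+ 2 <= 1 - c by apply: le_trans CS _; nra.
rewrite /den_sq; set x := z.1 * w.1 + z.2 * w.2 in CS *.
have xc : c / 2 <= 1 - x by nra.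
apply: (@le_trans _ _ ((1 - x) ^+ 2)); last by rewrite lerDl sqr_ge0.
by rewrite ler_sqr ?nnegrE//; lra.
Qed.

(** The square is a quotient [N / D] of polynomials. In terms of [h = |z - z'|], [N] varies by at
    most [8 h] and [D] by at most [12 h], while [N <= 8] and [D <= 9]. Hence [168 = 8 * 12 + 9 * 8],
    and the denominator comes from [den_sq_lb] used twice. *)
Lemma pseudo_dist_sqr_lip z z' w (c : R) : disk z -> disk z' -> disk w ->
  0 < c -> sqnorm w <= 1 - c ->
  `|pseudo_dist z w ^+ 2 - pseudo_dist z' w ^+ 2| <= 168 / (c / 2) ^+ 4 * `|z - z'|.
Proof.
move=> dz dz' dw c0 wc; set h := `|z - z'|.
have [h1 h2] : `|z.1 - z'.1| <= h /\ `|z.2 - z'.2| <= h.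
  by rewrite /h prod_normE /= !le_max !lexx orbT.
have h0 : 0 <= h by exact: normr_ge0.
have D1 := den_sq_lb dz (ltW c0) wc; have D2 := den_sq_lb dz' (ltW c0) wc.
have c2 : 0 < (c / 2) ^+ 2 by rewrite exprn_gt0// divr_gt0.
have D1p := lt_le_trans c2 D1; have D2p := lt_le_trans c2 D2.
rewrite !pseudo_dist_sqr.
have [z1 z2] := disk_coord dz; have [z1' z2'] := disk_coord dz'.
have [w1 w2] := disk_coord dw.
have ww : 0 <= 1 - sqnorm w <= 1.
  by move/diskE : dw; have := sqnorm_ge0 w; lra.
have zz : 0 <= 1 - sqnorm z <= 1.
  by move/diskE : dz; have := sqnorm_ge0 z; lra.
have prodle (a b A B : R) : `|a| <= A -> `|b| <= B -> `|a * b| <= A * B.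
  by move=> aA bB; rewrite normrM ler_pM.
have Nd : `|num_sq z w - num_sq z' w| <= 8 * h.
  rewrite (_ : _ - _ = (z.1 - z'.1) * (z.1 + z'.1 - 2 * w.1) +
    (z.2 - z'.2) * (z.2 + z'.2 - 2 * w.2)).
    apply: le_trans (ler_normD _ _) _.
    have a1 : `|z.1 + z'.1 - 2 * w.1| <= 4.
      by move: z1 z1' w1; rewrite !ler_norml; lra.
    have a2 : `|z.2 + z'.2 - 2 * w.2| <= 4.
      by move: z2 z2' w2; rewrite !ler_norml; lra.
    by have := prodle _ _ _ _ h1 a1; have := prodle _ _ _ _ h2 a2; lra.
  by rewrite /num_sq; ring.
have Sd : `|sqnorm z' - sqnorm z| <= 4 * h.
  rewrite (_ : _ - _ = - ((z.1 - z'.1) * (z.1 + z'.1) + (z.2 - z'.2) * (z.2 + z'.2))).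
    rewrite normrN; apply: le_trans (ler_normD _ _) _.
    have a1 : `|z.1 + z'.1| <= 2 by move: z1 z1'; rewrite !ler_norml; lra.
    have a2 : `|z.2 + z'.2| <= 2 by move: z2 z2'; rewrite !ler_norml; lra.
    by have := prodle _ _ _ _ h1 a1; have := prodle _ _ _ _ h2 a2; lra.
  by rewrite /sqnorm; ring.
have Dd : `|den_sq z w - den_sq z' w| <= 12 * h.
  rewrite !den_sq_num_sq (_ : _ - _ = (num_sq z w - num_sq z' w) +
    (sqnorm z' - sqnorm z) * (1 - sqnorm w)); last by ring.
  apply: le_trans (ler_normD _ _) _.
  have := @prodle _ (1 - sqnorm w) _ 1 Sd.
  rewrite [`|1 - _|]ger0_norm; last by case/andP: ww.
  by case/andP: ww => _ ww /(_ ww); lra.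
have N8 : `|num_sq z w| <= 8.
  rewrite ger0_norm ?num_sq_ge0// /num_sq.
  move: z1 z2 w1 w2; rewrite !ler_norml => /andP[? ?] /andP[? ?] /andP[? ?] /andP[? ?]; nra.
have D9 : `|den_sq z w| <= 9.
  rewrite ger0_norm ?den_sq_ge0// den_sq_num_sq.
  move: N8; rewrite ger0_norm ?num_sq_ge0//; nra.
rewrite (_ : _ - _ = (num_sq z w * (den_sq z' w - den_sq z w) +
    den_sq z w * (num_sq z w - num_sq z' w)) / (den_sq z w * den_sq z' w)); last first.
  by field; rewrite !gt_eqF.
rewrite normrM normfV [`|_ * den_sq z' w|]ger0_norm; last by rewrite mulr_ge0 ?den_sq_ge0.
rewrite ler_pdivrMr ?mulr_gt0//.
apply: (@le_trans _ _ (168 * h)).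
  apply: le_trans (ler_normD _ _) _.
  rewrite distrC in Dd; have := prodle _ _ _ _ N8 Dd; have := prodle _ _ _ _ D9 Nd.
  by lra.
have c4 : (c / 2) ^+ 4 = (c / 2) ^+ 2 * (c / 2) ^+ 2 by rewrite -exprD.
have DD : (c / 2) ^+ 4 <= den_sq z w * den_sq z' w.
  by rewrite c4 ler_pM// ltW.
rewrite (_ : _ / _ * h * _ = 168 * h * (den_sq z w * den_sq z' w / (c / 2) ^+ 4)); last by ring.
rewrite ler_peMr ?mulr_ge0// ler_pdivlMr ?mul1r//.
by rewrite exprn_gt0// divr_gt0.
Qed.

(* [s] and [s'] may vanish, where [ln] takes the junk value [0]: this is the
   diagonal of the kernel. *)
Lemma ln_dist_le (s s' : R) (n : R) : 1 <= n -> 0 <= s < 1 -> 0 <= s' < 1 ->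
  `|ln s - ln s'| <= (ln s ^+ 2 + ln s' ^+ 2) / n + n * expR n * `|s - s'|.
Proof.
move=> n1.
wlog ss : s s' / s <= s' => [H hs hs'|].
  have [?|?] := leP s s'; first exact: H.
  rewrite distrC (addrC (ln s ^+ 2)) [`|s - s'|]distrC; apply: H => //; exact: ltW.
move=> /andP[s0 s1] /andP[s0' s1'].
have n0 : 0 < n by lra.
have e0 : 0 < expR n by exact: expR_gt0.
have lt0 (x : R) : x < 1 -> ln x <= 0 by move=> x1; exact/ln_le0/ltW.
(* Large logarithms: for [x <= y <= 0] and [- x >= n], the difference is at most
   [- x <= x^2 / n]. *)
have big (x y : R) : n <= - x -> x <= y -> y <= 0 -> `|x - y| <= (x ^+ 2 + y ^+ 2) / n.
  by move=> nx xy y0; rewrite ler_pdivlMr// ler0_norm ?subr_le0//; nra.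
have sq0 (x y : R) : 0 <= (x ^+ 2 + y ^+ 2) / n.
  by rewrite divr_ge0 ?addr_ge0 ?sqr_ge0// ltW.
have ds0 : 0 <= n * expR n * `|s - s'| by rewrite !mulr_ge0 ?normr_ge0// ltW.
have l0 := lt0 _ s1; have l0' := lt0 _ s1'.
(* Moderate logarithms: the argument is at least [e^-n], where [ln] has Lipschitz constant at most
   [e^n]. *)
have ln_ge x : 0 < x -> - ln x < n -> 1 <= expR n * x.
  by move=> x0 xn; rewrite -ler_pdivrMr// div1r -(lnK x0) -expRN ler_expR ltW.
(* If [s = 0], then [ln s = 0] by convention and the left-hand side is [- ln s']. It is absorbed by
   its square over [n] if it is at least [n]; otherwise it is below [n <= n e^n s']. *)
have [s00|sn0] := eqVneq s 0.
  rewrite {1 2}s00 ln0//.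
  have [s00'|sn0'] := eqVneq s' 0.
    by rewrite {1 2}s00' ln0// subrr normr0 addr_ge0.
  have {}s0' : 0 < s' by rewrite lt0r sn0'.
  have [nl|nl] := leP n (- ln s').
    rewrite distrC (addrC (0 ^+ 2)).
    by rewrite (le_trans (big _ 0 nl l0' (lexx _)))// lerDl.
  have := ln_ge _ s0' nl.
  rewrite s00 sub0r normrN ler0_norm// sub0r normrN (gtr0_norm s0') => E.
  rewrite -[leLHS]add0r lerD//; nra.
have {}s0 : 0 < s by rewrite lt0r sn0.
have {}s0' : 0 < s' by exact: lt_le_trans ss.
have lns : ln s <= ln s' by rewrite ler_ln.
have [nl|nl] := leP n (- ln s).
  by rewrite (le_trans (big _ _ nl lns l0'))// lerDl.
have es := ln_ge _ s0 nl.
rewrite ler0_norm ?subr_le0// opprB -ln_div ?posrE//.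
have : ln (s' / s) <= (s' - s) / s.
  rewrite mulrBl divff ?gt_eqF// -{1}[s' / s](subrKC 1); apply: le_ln1Dx.
  by rewrite ltrBrDl subrr divr_gt0.
move/le_trans; apply; rewrite -[leLHS]add0r lerD// ler0_norm ?subr_le0// opprB.
rewrite ler_pdivrMr// -subr_ge0.
by rewrite (_ : _ - _ = (s' - s) * (n * (expR n * s) - 1)) ?mulr_ge0 ?subr_ge0//; [nra|ring].
Qed.
End PseudoDistance.

(** * Area and hyperbolic measure *)

Section PlaneMeasure.
Context {R : realType}.

Lemma ball_prod (z : R * R) (e : R) : ball z e = ball z.1 e `*` ball z.2 e.
Proof. by []. Qed.

Lemma measurable_ball_prod (z : R * R) (e : R) : measurable (ball z e : set (plane R)).
Proof. by rewrite ball_prod; apply: measurableX; exact: measurable_ball. Qed.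

Lemma area_ball (z : R * R) (e : R) : 0 <= e ->
  area (ball z e : set (plane R)) = (e *+ 2 * (e *+ 2))%:E.
Proof.
move=> e0.
have := @product_measure1E _ _ (measurableTypeR R) (measurableTypeR R) R
  lebesgue_measure lebesgue_measure _ _ (measurable_ball z.1 e) (measurable_ball z.2 e).
move=> E; apply: (eq_trans E); rewrite EFinM.
by congr (_ * _)%E; exact: lebesgue_measure_ball.
Qed.

(** An open set is the union of the balls contained in it that have rational centre and radius
    [1 / (n + 1)]. These are products of intervals for the maximum norm, and there are countably
    many. *)
Lemma open_measurable_plane (A : set (R * R)) : open A -> measurable (A : set (plane R)).
Proof.
move=> oA.
pose F (i : rat * rat * nat) : set (plane R) :=
  let B := ball ((ratr i.1.1, ratr i.1.2) : R * R) i.2.+1%:R^-1 in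
  [set w | B w /\ B `<=` A].
have -> : A = \bigcup_i F i.
  apply/seteqP; split=> [x Ax|x [i _ [Bx]]]; last by apply.
  have /nbhs_ballP[e /= e0 eA] : nbhs x A by apply: open_nbhs_nbhs; split.
  have e20 : 0 < e / 2 by rewrite divr_gt0.
  have [n _ nP] := near_infty_natSinv_lt (PosNum e20).
  have := nP n (leqnn n) => /= ne.
  have n0 : 0 < n.+1%:R^-1 :> R by rewrite invr_gt0.
  pose d : R := n.+1%:R^-1; rewrite -/d in ne n0.
  have near (y : R) : exists q : rat, `|ratr q - y| < d.
    have /rat_in_itvoo[q] : y - d < y + d by lra.
    by rewrite in_itv /= => ?; exists q; rewrite ltr_distl.
  have [q1 q1P] := near x.1; have [q2 q2P] := near x.2.
  exists ((q1, q2), n) => //; split=> [|y [/= y1 y2]]; first by split.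
  apply: eA; split; rewrite /ball /= -/d in y1 y2 *.
    rewrite -(subrKA (ratr q1)); apply: le_lt_trans (ler_normD _ _) _.
    by rewrite distrC in q1P; lra.
  rewrite -(subrKA (ratr q2)); apply: le_lt_trans (ler_normD _ _) _.
  by rewrite distrC in q2P; lra.
apply: countable_bigcupT_measurable => [|i]; first exact: countableP.
have [BA|BA] := pselect (ball ((ratr i.1.1, ratr i.1.2) : R * R) i.2.+1%:R^-1 `<=` A).
  rewrite (_ : F i = ball ((ratr i.1.1, ratr i.1.2) : R * R) i.2.+1%:R^-1).
    exact: measurable_ball_prod.
  by apply/seteqP; split=> // x [].
by rewrite (_ : F i = set0)//; apply/seteqP; split=> // x [].
Qed.

Lemma hyp_measure_le (c : R) (A : set (plane R)) : 0 < c -> measurable A ->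
  (forall w, A w -> sqnorm w <= 1 - c) ->
  (hyp_measure A <= (pi^-1 * (c ^+ 2)^-1)%:E * area A)%E.
Proof.
move=> c0 mA Ac; rewrite /hyp_measure.
have -> : A `&` disk = A.
  by apply/setIidPl => w /Ac wc; apply/diskE; apply: le_lt_trans wc _; lra.
rewrite -integral_cst//; apply: ge0_le_integral => //.
- by move=> w _; rewrite lee_fin hyp_density_ge0.
- by apply: measurable_funTS; apply/measurable_EFinP; exact: measurable_hyp_density.
- move=> w /Ac wc; rewrite lee_fin /hyp_density cabs_sqr.
  rewrite ler_wpM2l ?invr_ge0 ?pi_ge0// lef_pV2 ?posrE ?exprn_gt0//; last by lra.
  by rewrite ler_sqr ?nnegrE; lra.
Qed.

(** The density is at least [1 / pi] on the disk. Through this bound a ball in the disk is not a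
    null set. *)
Lemma hyp_measure_ge (A : set (plane R)) : measurable A -> A `<=` disk ->
  ((pi^-1)%:E * area A <= hyp_measure A)%E.
Proof.
move=> mA Ad; rewrite /hyp_measure (_ : A `&` disk = A); last exact/setIidPl.
rewrite -integral_cst//; apply: ge0_le_integral => //.
- by move=> w _; rewrite lee_fin invr_ge0 pi_ge0.
- by apply: measurable_funTS; apply/measurable_EFinP; exact: measurable_hyp_density.
- move=> w /Ad /diskE w1; rewrite lee_fin /hyp_density cabs_sqr.
  have w0 := sqnorm_ge0 w.
  rewrite ler_peMr ?invr_ge0 ?pi_ge0// invf_ge1 ?exprn_gt0//; last by lra.
  by rewrite expr_le1//; lra.
Qed.

Lemma hyp_measure_null (A : set (plane R)) : measurable A -> area A = 0%E ->
  hyp_measure A = 0%E.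
Proof.
move=> mA A0; rewrite /hyp_measure; apply: null_set_integral.
- by apply: measurableI => //; exact: measurable_disk.
- by apply: measurable_funTS; apply/measurable_EFinP; exact: measurable_hyp_density.
- apply/le_anti/andP; split=> //; rewrite -[X in (_ <= X)%E]A0 le_measure ?inE//.
  by apply: measurableI => //; exact: measurable_disk.
Qed.

Lemma measurable_num_sq (z : R * R) : measurable_fun [set: plane R] (num_sq z).
Proof.
by apply: measurable_funD; apply: measurable_funX; apply: measurable_funB.
Qed.

Lemma measurable_den_sq (z : R * R) : measurable_fun [set: plane R] (den_sq z).
Proof.
apply: measurable_funD; apply: measurable_funX; apply: measurable_funB => //.
- by apply: measurable_funD; apply: measurable_funM.
- by apply: measurable_funM.
- by apply: measurable_funM.
Qed.

Lemma measurable_pseudo_circle (z : R * R) (r : R) :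
  measurable ([set w | num_sq z w = r ^+ 2 * den_sq z w] : set (plane R)).
Proof.
rewrite (_ : [set w | _] = (fun w => num_sq z w - r ^+ 2 * den_sq z w) @^-1` [set 0]).
  rewrite -[X in measurable X]setTI.
  have : measurable_fun [set: plane R] (fun w => num_sq z w - r ^+ 2 * den_sq z w).
    apply: measurable_funB; first exact: measurable_num_sq.
    by apply: measurable_funM => //; exact: measurable_den_sq.
  exact.
by apply/seteqP; split=> w /= => [->|/eqP]; rewrite ?subrr// subr_eq0 => /eqP.
Qed.

(** On each line of constant first coordinate the equation is quadratic in the second one, with
    leading coefficient [1 - r^2 |z|^2 != 0]. Every section thus has at most two points. The case
    [r = 0] is the point [z] itself. *)
Lemma hyp_measure_pseudo_circle (z : R * R) (r : R) : disk z -> 0 <= r < 1 ->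
  hyp_measure [set w | num_sq z w = r ^+ 2 * den_sq z w] = 0%E.
Proof.
move=> /diskE z1 /andP[r0 r1]; apply: hyp_measure_null.
  exact: measurable_pseudo_circle.
rewrite /area /product_measure1; apply: integral0_eq => x _ /=.
set S := xsection _ _.
have [[y0 Sy0]|S0] := pselect (exists y, S y); last first.
  by rewrite (_ : S = set0) ?measure0// -subset0 => y Sy; apply: S0; exists y.
pose a := 1 - r ^+ 2 * sqnorm z.
pose b := - 2 * (z.2 - r ^+ 2 * ((1 - z.1 * x) * z.2 + z.1 * z.2 * x)).
have a0 : a != 0.
  rewrite /a subr_eq0 eq_sym lt_eqF//.
  have := sqnorm_ge0 z; have : 0 <= r ^+ 2 < 1 by rewrite sqr_ge0 expr_lt1.
  nra.
have Sy y : S y -> num_sq z (x, y) = r ^+ 2 * den_sq z (x, y) by rewrite /S /xsection /= inE.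
(* By Vieta, the roots of [a y^2 + b y + const] add up to [- b / a]. *)
have : S `<=` [set y0; - b / a - y0].
  move=> y /Sy Hy; have {}Sy0 := Sy _ Sy0.
  have : (y - y0) * (a * (y + y0) + b) = 0.
    rewrite -[RHS](subrr (r ^+ 2 * den_sq z (x, y) - r ^+ 2 * den_sq z (x, y0))).
    rewrite -[X in _ = X - _](congr2 (fun u v => u - v) Hy Sy0).
    by rewrite /a /b /num_sq /den_sq /sqnorm /=; ring.
  move/eqP; rewrite mulf_eq0 subr_eq0 => /orP[/eqP ->|/eqP E]; first by left.
  right => /=; apply: (mulfI a0); rewrite mulrBr mulrCA divff// mulr1.
  by apply/eqP; rewrite -subr_eq0 -[X in _ == X]E; apply/eqP; ring.
move=> sub; apply: countable_lebesgue_measure0.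
by apply: sub_countable (subset_card_le sub) _; apply: finite_set_countable; exact: finite_set2.
Qed.
End PlaneMeasure.

(** * Logarithmic potentials *)

Section Kernel.
Context {R : realType}.
Implicit Types z w : R * R.

Definition log_kernel z w : R := ln (pseudo_dist z w)^-1.

Lemma measurable_log_kernel z : measurable_fun [set: plane R] (log_kernel z).
Proof.
rewrite (_ : log_kernel z = fun w => - ln (num_sq z w * (powR (den_sq z w) (- 1))) / 2).
  apply: measurable_funM => //; apply: measurable_funN.
  apply: measurableT_comp; first exact: measurable_ln.
  apply: measurable_funM; first exact: measurable_num_sq.
  exact: (measurableT_comp (measurable_powR (- 1)) (measurable_den_sq z)).
by apply/funext => w; rewrite /log_kernel ln_pseudo_distV powR_inv1 ?den_sq_ge0.
Qed.

Lemma log_kernel_ge0 z w : disk z -> disk w -> 0 <= log_kernel z w.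
Proof.
move=> dz dw; rewrite /log_kernel ln_invr ?pseudo_dist_ge0// oppr_ge0.
exact/ln_le0/ltW/pseudo_dist_lt1.
Qed.

(** For [k >= 0] one has [k^4 / 24 <= e^k], and here [e^k = 1 / [z, w] <= 3 / |z - w|] because
    [|1 - conj(z) w|^2 <= 9]. This gives [72 = 24 * 3]. On the diagonal the kernel is 0 by
    convention. *)
Lemma log_kernel_pow4 z w : disk z -> disk w ->
  log_kernel z w ^+ 4 <= 72 * `|z - w|^-1.
Proof.
move=> dz dw; have k0 := log_kernel_ge0 dz dw.
have [wz|zw] := eqVneq (num_sq z w) 0.
  rewrite /log_kernel ln_pseudo_distV wz mul0r ln0// oppr0 mul0r expr0n.
  by rewrite mulr_ge0// invr_ge0.
have N0 : 0 < num_sq z w by rewrite lt0r zw num_sq_ge0.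
have D0 := den_sq_gt0 dz dw.
have p0 : 0 < pseudo_dist z w by rewrite pseudo_distE sqrtr_gt0 divr_gt0.
have zw0 : 0 < `|z - w| by rewrite normr_gt0 subr_eq0 -num_sq_eq0.
have : 1 + log_kernel z w ^+ 4 / 24 <= (pseudo_dist z w)^-1.
  have := expR_ge1Dxn 3 k0; rewrite (_ : 4`!%:R = 24 :> R)//.
  by rewrite [X in expR X]/log_kernel lnK ?posrE ?invr_gt0.
have : (pseudo_dist z w)^-1 <= 3 * `|z - w|^-1.
  rewrite pseudo_distE sqrtrM ?num_sq_ge0// sqrtrV ?den_sq_ge0// invfM invrK mulrC.
  rewrite ler_pM ?sqrtr_ge0 ?invr_ge0 ?sqrtr_ge0//; last first.
    by rewrite lef_pV2 ?posrE ?sqrtr_gt0// num_sq_ge_norm.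
  rewrite (_ : 3 = Num.sqrt 9); last first.
    by rewrite (_ : 9 = 3 ^+ 2) ?sqrtr_sqr ?ger0_norm//; ring.
  rewrite ler_wsqrtr//.
  have [z1 z2] := disk_coord dz; have [w1 w2] := disk_coord dw.
  move/diskE : dz => zz; move/diskE : dw => ww.
  have := sqnorm_ge0 z; have := sqnorm_ge0 w.
  rewrite den_sq_num_sq /num_sq.
  move: z1 z2 w1 w2; rewrite !ler_norml => /andP[? ?] /andP[? ?] /andP[? ?] /andP[? ?]; nra.
by lra.
Qed.

(* Compares [1 / |z - w|] with a series of indicators of dyadic balls, whose area
   integral is elementary. *)
Lemma inv_norm_dyadic (t : R) : 0 <= t -> exists n : nat,
  t^-1 <= 1 + 2 ^+ n.+1 * (t < (2 ^+ n)^-1)%R%:R.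
Proof.
rewrite le_eqVlt => /predU1P[<-|t0].
  by exists 0%N; rewrite invr0 addr_ge0// mulr_ge0// exprn_ge0.
have [t1|t1] := leP 1 t.
  exists 0%N; apply: (@le_trans _ _ 1); first by rewrite invf_le1.
  by rewrite lerDl mulr_ge0// exprn_ge0.
have ex : exists n : nat, t^-1 <= 2 ^+ n.+1.
  exists (Num.bound t^-1); apply: (@le_trans _ _ (Num.bound t^-1)%:R).
    by apply/ltW/archi_boundP; rewrite invr_ge0 ltW.
  by rewrite -natrX ler_nat; apply/ltnW/ltnW/ltn_expl.
(* For the least [n] with [1 / t <= 2^(n+1)], minimality gives [t < 2^-n], so the indicator is 1;
   for [n = 0] this is [t < 1]. *)
case: (ex_minnP ex) => n tn nmin; exists n.
have -> : t < (2 ^+ n)^-1.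
  case: n tn nmin => [|n] tn nmin; first by rewrite expr0 invr1.
  rewrite -[t]invrK ltf_pV2 ?posrE ?invr_gt0 ?exprn_gt0//.
  rewrite ltNge; apply/negP => /nmin; by rewrite ltnn.
by rewrite mulr1; apply: le_trans tn _; rewrite lerDr.
Qed.

End Kernel.

(** * Uniform integral bounds for the kernel away from the unit circle *)

Section KernelIntegral.
Context {R : realType} (Omega : set (plane R)) (c : R).
Context (mO : measurable Omega) (c0 : 0 < c)
  (Oc : forall w, Omega w -> sqnorm w <= 1 - c).
Local Notation mu := (@hyp_measure R).

Let C : R := pi^-1 * (c ^+ 2)^-1.

Let C0 : 0 <= C. Proof. by rewrite mulr_ge0 ?invr_ge0 ?pi_ge0 ?sqr_ge0. Qed.

Lemma disk_hyp_bounded w : Omega w -> disk w.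
Proof. by move=> /Oc wc; apply/diskE; apply: le_lt_trans wc _; rewrite gtrBl. Qed.

Lemma hyp_measure_ball (z : R * R) (e : R) : 0 <= e ->
  (mu (Omega `&` ball z e) <= (C * (e *+ 2 * (e *+ 2)))%:E)%E.
Proof.
move=> e0; have mB := @measurable_ball_prod R z e.
have mI : measurable (Omega `&` (ball z e : set (plane R))) by exact: measurableI.
apply: (le_trans (hyp_measure_le c0 mI _)); first by move=> w [/Oc].
rewrite -/C [leRHS]EFinM; apply: lee_wpmul2l; first by rewrite lee_fin.
rewrite -(area_ball z e0).
by apply: le_measure; rewrite ?inE//; exact: subIsetr.
Qed.

Lemma hyp_measure_lty : (mu Omega < +oo)%E.
Proof.
have -> : Omega = Omega `&` ball (0 : R * R) 2.
  apply/esym/setIidPl => w Ow; have [w1 w2] := disk_coord (disk_hyp_bounded Ow).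
  by split; rewrite /ball /= sub0r normrN; lra.
by apply: le_lt_trans (hyp_measure_ball 0 _) _ => //; rewrite ltry.
Qed.

(** By [log_kernel_pow4] and the dyadic comparison, it suffices to sum the measures of the balls of
    radius [2^-n] with weights [2^(n+1)]. Each is at most [4 C 4^-n] whatever the centre, so [K]
    does not depend on [z]. *)
Lemma integral_log_kernel_pow4 : exists2 K : R, 0 <= K & forall z, disk z ->
  (\int[mu]_(w in Omega) (log_kernel z w ^+ 4)%:E <= K%:E)%E.
Proof.
have mO0 : 0 <= fine (mu Omega) by rewrite fine_ge0.
exists (72 * (fine (mu Omega) + 16 * C)).
  by rewrite mulr_ge0// addr_ge0// mulr_ge0.
move=> z dz.
pose g (n : nat) (w : plane R) : \bar R :=
  (2 ^+ n.+1 * (\1_(ball z (2 ^+ n)^-1) w))%:E.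
have g0 n w : (0 <= g n w)%E by rewrite lee_fin mulr_ge0// exprn_ge0.
have mB n := @measurable_ball_prod R z (2 ^+ n)^-1.
have mg n : measurable_fun Omega (g n).
  by apply/measurable_EFinP; apply: measurable_funM.
have ms : measurable_fun Omega (fun w => (\sum_(n <oo) g n w)%E).
  exact: ge0_emeasurable_sum.
have mk : measurable_fun Omega (fun w => (log_kernel z w ^+ 4)%:E).
  apply/measurable_EFinP/measurable_funX; apply: measurable_funTS.
  exact: measurable_log_kernel.
have m1 : measurable_fun Omega (fun w => (1 + \sum_(n <oo) g n w)%E).
  exact: emeasurable_funD.
apply: (@le_trans _ _ (\int[mu]_(w in Omega) (72%:E * (1 + \sum_(n <oo) g n w)))%E).
  apply: ge0_le_integral => //.
  - by move=> w _; rewrite lee_fin exprn_even_ge0.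
  - exact: emeasurable_funM.
  - move=> w Ow; have dw := disk_hyp_bounded Ow.
    apply: (@le_trans _ _ (72%:E * (`|z - w|^-1)%:E)%E).
      by rewrite -EFinM lee_fin log_kernel_pow4.
    apply: lee_wpmul2l; first by rewrite lee_fin.
    have [n hn] := inv_norm_dyadic (normr_ge0 (z - w)).
    apply: (@le_trans _ _ (1 + g n w)%E).
      rewrite -EFinD lee_fin; apply: le_trans hn _.
      rewrite lerD2l ler_wpM2l ?exprn_ge0// indicE.
      case: ltP => // zw; rewrite mem_set//.
      by move: zw; rewrite prod_normE gt_max => /andP[].
    rewrite leeD2l//; apply: le_trans (nneseries_lim_ge n.+1 _) => //.
    by rewrite big_nat_recr//= leeDr// sume_ge0.
rewrite ge0_integralZl//; last by move=> w _; rewrite adde_ge0// nneseries_ge0.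
rewrite [leRHS]EFinM; apply: lee_wpmul2l; first by rewrite lee_fin.
rewrite ge0_integralD//; last by move=> w _; rewrite nneseries_ge0.
rewrite integral_cst// mul1e EFinD fineK; last first.
  by rewrite ge0_fin_numE// hyp_measure_lty.
rewrite leeD2l// integral_nneseries//.
(* The [n]-th term is at most [2^(n+1) * 4 C 4^-n = 16 C / 2^(n+1)], a geometric series with sum
   [16 C]. *)
have <- : (\sum_(n <oo) ((16 * C / (2 ^ (n + 1))%:R)%:E))%E = (16 * C)%:E.
  by have := @cvg_geometric_eseries_half R (16 * C) 0; rewrite expr0 divr1; exact: cvg_lim.
apply: lee_nneseries => n _.
  by move=> _; apply: integral_ge0.
rewrite /g; under eq_integral do rewrite EFinM.
rewrite ge0_integralZl//; last exact/measurable_EFinP.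
rewrite integral_indic// setIC.
have h0 : 0 < 2 ^+ n :> R by rewrite exprn_gt0.
apply: (@le_trans _ _ ((2 ^+ n.+1)%:E * (C * ((2 ^+ n)^-1 *+ 2 * ((2 ^+ n)^-1 *+ 2)))%:E)%E).
  apply: lee_wpmul2l; first by rewrite lee_fin exprn_ge0.
  by apply: hyp_measure_ball; rewrite invr_ge0 ltW.
rewrite -EFinM lee_fin addn1 natrX !exprS !mulr2n le_eqVlt; apply/orP; left; apply/eqP.
by field; rewrite gt_eqF.
Qed.

(** * Convergence and continuity estimates for the potential of a square-integrable function *)

Section Potential.
Context (u : plane R -> R) (hu : L2 Omega u).

Let mass := fine (mu Omega).
Let energy := fine (\int[mu]_(w in Omega) (u w ^+ 2)%:E)%E.

Let mass0 : 0 <= mass. Proof. by rewrite fine_ge0. Qed.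

Let energy0 : 0 <= energy.
Proof. by apply/fine_ge0/integral_ge0 => w _; rewrite lee_fin sqr_ge0. Qed.

Let massE : mu Omega = mass%:E.
Proof. by rewrite /mass fineK// ge0_fin_numE// hyp_measure_lty. Qed.

Let energyE : (\int[mu]_(w in Omega) (u w ^+ 2)%:E)%E = energy%:E.
Proof.
rewrite /energy fineK// ge0_fin_numE; first by case: hu.
by apply: integral_ge0 => w _; rewrite lee_fin sqr_ge0.
Qed.

(** Reduces integral estimates to pointwise ones: it serves both for the convergence of the
    potential and for its modulus of continuity. *)
Lemma integral_abs_le_pow4 (K : R) :
  (forall z, disk z -> \int[mu]_(w in Omega) (log_kernel z w ^+ 4)%:E <= K%:E)%E ->
  forall z z' (a b d e : R) (f : plane R -> R), disk z -> disk z' ->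
  0 <= a -> 0 <= b -> 0 <= d -> 0 <= e -> measurable_fun Omega f ->
  (forall w, Omega w -> `|f w| <=
     a * log_kernel z w ^+ 4 + b * log_kernel z' w ^+ 4 + d * u w ^+ 2 + e) ->
  (\int[mu]_(w in Omega) `|(f w)%:E| <= (a * K + b * K + d * energy + e * mass)%:E)%E.
Proof.
move=> HK z z' a b d e f dz dz' a0 b0 d0 e0 mf fle.
have mk y : measurable_fun Omega (fun w => (log_kernel y w ^+ 4)%:E).
  apply/measurable_EFinP/measurable_funX; apply: measurable_funTS.
  exact: measurable_log_kernel.
have mu2 : measurable_fun Omega (fun w => (u w ^+ 2)%:E).
  by apply/measurable_EFinP/measurable_funX; case: hu.
have k0 y w : (0 <= (log_kernel y w ^+ 4)%:E)%E by rewrite lee_fin exprn_even_ge0.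
have u0 w : (0 <= (u w ^+ 2)%:E)%E by rewrite lee_fin sqr_ge0.
apply: (@le_trans _ _ (\int[mu]_(w in Omega)
   (a%:E * (log_kernel z w ^+ 4)%:E + b%:E * (log_kernel z' w ^+ 4)%:E +
    d%:E * (u w ^+ 2)%:E + e%:E))%E).
  apply: ge0_le_integral => //.
  - by apply: measurableT_comp => //; exact/measurable_EFinP.
  - apply: emeasurable_funD => //; apply: emeasurable_funD; last exact: emeasurable_funM.
    by apply: emeasurable_funD; exact: emeasurable_funM.
have m1 y q : measurable_fun Omega (fun w => q%:E * (log_kernel y w ^+ 4)%:E)%E.
  exact: emeasurable_funM.
have m2 : measurable_fun Omega (fun w => d%:E * (u w ^+ 2)%:E)%E.
  exact: emeasurable_funM.
have g1 y q w : 0 <= q -> (0 <= q%:E * (log_kernel y w ^+ 4)%:E)%E.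
  by move=> q0; rewrite mule_ge0.
have g2 w : (0 <= d%:E * (u w ^+ 2)%:E)%E by rewrite mule_ge0.
rewrite ge0_integralD//; first last.
- apply: emeasurable_funD => //; exact: emeasurable_funD.
- by move=> w _; rewrite !adde_ge0// g1.
rewrite ge0_integralD//; first last.
- exact: emeasurable_funD.
- by move=> w _; rewrite !adde_ge0// g1.
rewrite ge0_integralD//; [|by move=> w _; exact: g1..].
rewrite !ge0_integralZl//; try by rewrite lee_fin.
rewrite [X in (d%:E * X)%E]energyE integral_cst// [X in (e%:E * X)%E]massE !EFinD !EFinM.
by rewrite !leeD//; apply: lee_wpmul2l; rewrite ?lee_fin// HK.
Qed.

(** Combine [2 k v <= k^2 + v^2] with [k^2 <= k^4 + 1 / 4]. *)
Lemma log_kernel_mul_abs_le z w : disk z -> Omega w ->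
  `|log_kernel z w * u w| <= log_kernel z w ^+ 4 + u w ^+ 2 + 1.
Proof.
move=> dz Ow; have k0 := log_kernel_ge0 dz (disk_hyp_bounded Ow).
rewrite normrM (ger0_norm k0) -[u w ^+ 2]real_normK ?num_real//.
have := normr_ge0 (u w); set k := log_kernel z w in k0 *; set v := `|u w| => v0.
have : 0 <= (k ^+ 2 - 1 / 2) ^+ 2 by exact: sqr_ge0.
have : 0 <= (k - v) ^+ 2 by exact: sqr_ge0.
rewrite (_ : k ^+ 4 = (k ^+ 2) ^+ 2); last by rewrite -exprM.
nra.
Qed.

Lemma measurable_log_kernel_mul z :
  measurable_fun Omega (fun w => log_kernel z w * u w).
Proof.
apply: measurable_funM; last by case: hu.
by apply: measurable_funTS; exact: measurable_log_kernel.
Qed.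

(** The uniformity in [z] is what allows Fubini's theorem along a circle. *)
Lemma integral_log_kernel_mul_bound : exists M : R, forall z, disk z ->
  (\int[mu]_(w in Omega) `|(log_kernel z w * u w)%:E| <= M%:E)%E.
Proof.
have [K K0 HK] := integral_log_kernel_pow4.
eexists => z dz; apply: (@integral_abs_le_pow4 K HK z z 1 0 1 1 _ dz dz) => //.
- exact: measurable_log_kernel_mul.
- by move=> w Ow; rewrite mul0r addr0 !mul1r; exact: log_kernel_mul_abs_le.
Qed.

Lemma integrable_log_kernel_mul z : disk z ->
  mu.-integrable Omega (fun w => (log_kernel z w * u w)%:E).
Proof.
move=> dz; apply/integrableP; split.
  by apply/measurable_EFinP; exact: measurable_log_kernel_mul.
have [M HM] := integral_log_kernel_mul_bound.
by apply: le_lt_trans (HM z dz) _; rewrite ltry.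
Qed.

(** A real number without the factor 1/2 of [log_potential]; [potentialE] shows that no infinite
    value is lost on the disk. *)
Definition potential z : R := (\int[mu]_(w in Omega) (log_kernel z w * u w))%R.

Lemma potentialE z : disk z ->
  (\int[mu]_(w in Omega) (log_kernel z w * u w)%:E)%E = (potential z)%:E.
Proof.
move=> dz; rewrite /potential /Rintegral fineK//.
by apply: integrable_fin_num => //; exact: integrable_log_kernel_mul.
Qed.

(** This is [ln_dist_le] for the squared pseudo-distances, which are Lipschitz in the first point.
    The kernel is [-1/2] times the logarithm of the square, whence the factor 2. *)
Lemma log_kernel_dist z z' w (n : R) : disk z -> disk z' -> Omega w -> 1 <= n ->
  `|log_kernel z w - log_kernel z' w| <=
  2 * (log_kernel z w ^+ 2 + log_kernel z' w ^+ 2) / n +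
  n * expR n * (168 / (c / 2) ^+ 4 * `|z - z'|).
Proof.
move=> dz dz' Ow n1; have dw := disk_hyp_bounded Ow.
have kE y : disk y -> log_kernel y w = - ln (pseudo_dist y w ^+ 2) / 2.
  by move=> dy; rewrite /log_kernel ln_pseudo_distV pseudo_dist_sqr.
have s01 y : disk y -> 0 <= pseudo_dist y w ^+ 2 < 1.
  by move=> dy; rewrite sqr_ge0 expr_lt1 ?pseudo_dist_ge0//= pseudo_dist_lt1.
have := ln_dist_le n1 (s01 _ dz) (s01 _ dz').
have := pseudo_dist_sqr_lip dz dz' dw c0 (Oc Ow).
rewrite !kE//; set x := ln _; set y := ln _ => L.
set T := n * expR n.
have T0 : 0 <= T by rewrite mulr_ge0 ?expR_ge0//; lra.
have := ler_wpM2l T0 L; set A := T * _; set B := T * _ => AB xy.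
rewrite (_ : - x / 2 - - y / 2 = - ((x - y) / 2)); last by ring.
rewrite normrN normrM (@ger0_norm _ 2^-1)//.
rewrite (_ : 2 * _ / n = (x ^+ 2 + y ^+ 2) / n / 2); last first.
  by field; lra.
have A0 : 0 <= A by rewrite mulr_ge0.
have B0 : 0 <= B by exact: le_trans A0 AB.
have := normr_ge0 (x - y); lra.
Qed.

(** The parameter [n] gives continuity: a large [n] makes the first term small, and then a small
    [|z - z'|] the second. *)
Lemma potential_dist : exists2 M : R, 0 <= M & forall z z' (n : R), disk z -> disk z' -> 1 <= n ->
  `|potential z - potential z'| <= M / n + n * expR n * M * `|z - z'|.
Proof.
have [K K0 HK] := integral_log_kernel_pow4.
have c4 : 0 < (c / 2) ^+ 4 by rewrite exprn_gt0// divr_gt0.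
pose L := 168 / (c / 2) ^+ 4.
have L0 : 0 <= L by rewrite divr_ge0// ltW.
exists (4 * (K + energy) + L * (mass + energy)).
  by rewrite addr_ge0// mulr_ge0// addr_ge0.
move=> z z' n dz dz' n1.
have n0 : 0 < n by lra.
have iz := integrable_log_kernel_mul dz; have iz' := integrable_log_kernel_mul dz'.
rewrite /potential -RintegralB//.
apply: le_trans (le_normr_Rintegral _ _) _ => //.
  by have := integrableB mO iz iz'; exact.
rewrite /Rintegral -lee_fin fineK; last first.
  apply: integrable_fin_num => //.
  by have := integrable_norm (integrableB mO iz iz'); exact.
set h := `|z - z'|; set E := n * expR n * (L * h).
have h0 : 0 <= h := normr_ge0 _.
have n0' := ltW n0; have e0 := expR_ge0 n.
have E0 : 0 <= E by apply: mulr_ge0; apply: mulr_ge0.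
have n20 : 0 <= 2 / n by rewrite divr_ge0// ltW.
(* The coefficients come from [2 k^2 v <= k^4 + v^2], with some room, and from [v <= v^2 + 1], with
   [v = |u w|]. *)
have := @integral_abs_le_pow4 K HK z z' (2 / n) (2 / n) (4 / n + E) E
  (fun w => log_kernel z w * u w - log_kernel z' w * u w) dz dz' n20 n20.
move=> /(_ _ _ _ _)/le_trans; apply => //.
- by apply: addr_ge0 => //; rewrite divr_ge0.
- by apply: measurable_funB; exact: measurable_log_kernel_mul.
- move=> w Ow; rewrite -mulrBl normrM.
  have := log_kernel_dist dz dz' Ow n1; rewrite -/L -/h -/E.
  rewrite -[u w ^+ 2]real_normK ?num_real//.
  set k := log_kernel z w; set k' := log_kernel z' w; set v := `|u w|.
  have v0 : 0 <= v by exact: normr_ge0.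
  move=> kk'; apply: le_trans (ler_wpM2r v0 kk') _.
  rewrite -subr_ge0 (_ : _ - _ = (k ^+ 2 - v) ^+ 2 / n + (k' ^+ 2 - v) ^+ 2 / n +
    (k ^+ 4 + k' ^+ 4 + 2 * v ^+ 2) / n + E * ((v - 1/2) ^+ 2 + 3 / 4)); last first.
    by field; lra.
  have p1 (x : R) : 0 <= x ^+ 2 / n by rewrite divr_ge0// sqr_ge0.
  have p2 : 0 <= k ^+ 4 + k' ^+ 4 + 2 * v ^+ 2.
    by apply: addr_ge0; [apply: addr_ge0|apply: mulr_ge0]; rewrite ?exprn_even_ge0.
  have p3 : 0 <= (v - 1 / 2) ^+ 2 + 3 / 4 by rewrite addr_ge0 ?sqr_ge0// divr_ge0.
  by apply: addr_ge0; [apply: addr_ge0; [exact: addr_ge0|exact: divr_ge0]|exact: mulr_ge0].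
- rewrite lee_fin /E -subr_ge0.
  rewrite (_ : _ - _ = L * (mass + energy) / n + n * expR n * h * 4 * (K + energy)); last first.
    by field; lra.
  apply: addr_ge0; first by rewrite divr_ge0// mulr_ge0// addr_ge0.
  by apply: mulr_ge0; rewrite ?addr_ge0//; do 3 apply: mulr_ge0 => //.
Qed.

End Potential.
End KernelIntegral.
(** * Circle means of potentials *)

Section FubiniRestr.
Context d1 d2 (X : measurableType d1) (Y : measurableType d2) (R : realType).

Lemma integral_mfrestr d (T : measurableType d) (m : {measure set T -> \bar R})
    (A : set T) (mA : measurable A) (moo : (m A < +oo)%E) (g : T -> \bar R) :
  (\int[mfrestr mA moo]_x (g \_ A) x = \int[m]_(x in A) g x)%E.
Proof.
rewrite -integral_mkcond; apply: eq_measure_integral => E mE EA.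
by rewrite /mfrestr /mrestr; congr (m _); exact/setIidPl.
Qed.

Lemma integrable_mfrestr d (T : measurableType d) (m : {measure set T -> \bar R})
    (A : set T) (mA : measurable A) (moo : (m A < +oo)%E) (g : T -> \bar R) :
  (mfrestr mA moo).-integrable setT (g \_ A) -> m.-integrable A g.
Proof.
move=> /(integrable_mkcond g mA) /integrableP[mg goo]; apply/integrableP; split=> //.
rewrite (@eq_measure_integral _ _ _ _ (mfrestr mA moo))// => E mE EA.
by rewrite /mfrestr /mrestr; congr (m _); apply/esym/setIidPl.
Qed.

(** Restricting the measures to [A] and [B] makes them finite, and [f] is extended by 0. The bound
    [M] on the inner integrals and the finiteness of [m1 A] give integrability on the product. *)
Lemma Fubini_restr (m1 : {measure set X -> \bar R}) (m2 : {measure set Y -> \bar R})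
    (A : set X) (B : set Y) (mA : measurable A) (mB : measurable B)
    (fA : (m1 A < +oo)%E) (fB : (m2 B < +oo)%E) (f : X * Y -> R) (M : R) :
  measurable_fun (A `*` B) f ->
  (forall x, A x -> \int[m2]_(y in B) `|(f (x, y))%:E| <= M%:E)%E ->
  [/\ m1.-integrable A (fun x => \int[m2]_(y in B) (f (x, y))%:E)%E,
      measurable_fun B (fun y => \int[m1]_(x in A) (f (x, y))%:E)%E &
      (\int[m1]_(x in A) \int[m2]_(y in B) (f (x, y))%:E =
       \int[m2]_(y in B) \int[m1]_(x in A) (f (x, y))%:E)%E].
Proof.
move=> mf fM.
pose n1 := mfrestr mA fA; pose n2 := mfrestr mB fB.
pose F : X * Y -> \bar R := (EFin \o f) \_ (A `*` B).
have mAB : measurable (A `*` B) by exact: measurableX.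
have mF : measurable_fun setT F.
  by apply/(measurable_restrictT _ mAB)/measurable_EFinP.
(* [h] is [abse] for the integrability and the identity for the exchange of integrals. *)
have Fx (h : \bar R -> \bar R) : h 0%E = 0%E ->
    (fun x => \int[n2]_y h (F (x, y)))%E =
    (fun x => \int[m2]_(y in B) h (f (x, y))%:E)%E \_ A.
  move=> h0; apply/funext => x; rewrite patchE; case: ifPn => [|] xA.
    rewrite -(integral_mfrestr mB fB); apply: eq_integral => y _.
    rewrite /F !patchE in_setX xA /=; case: ifPn => //.
  apply: integral0_eq => y _.
  by rewrite /F patchE in_setX (negbTE xA)/=.
have Fy (h : \bar R -> \bar R) : h 0%E = 0%E ->
    (fun y => \int[n1]_x h (F (x, y)))%E =
    (fun y => \int[m1]_(x in A) h (f (x, y))%:E)%E \_ B.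
  move=> h0; apply/funext => y; rewrite patchE; case: ifPn => [|] yB.
    rewrite -(integral_mfrestr mA fA); apply: eq_integral => x _.
    rewrite /F !patchE in_setX yB andbT /=; case: ifPn => //.
  apply: integral0_eq => x _.
  by rewrite /F patchE in_setX (negbTE yB)/= andbF.
have iF : (n1 \x n2)%E.-integrable setT F.
  apply/(integrable12ltyP _ _ mF).
  have -> := Fx abse abse0.
  rewrite integral_mfrestr.
  (* If [A] is empty, [M] may be negative. *)
  apply: (@le_lt_trans _ _ (\int[m1]_(x in A) (Num.max M 0)%:E)%E).
    apply: ge0_le_integral => //.
    - by move=> x Ax; apply: integral_ge0.
    - have := @measurable_fun_fubini_tonelli_F _ _ X Y R n2 (abse \o F).
      have mFa : measurable_fun setT (abse \o F) by exact: measurableT_comp.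
      move=> /(_ mFa (fun _ => abse_ge0 _)).
      rewrite /fubini_F /= (Fx abse abse0).
      by move=> ?; exact/(measurable_restrictT _ mA).
    - by move=> x Ax; apply: le_trans (fM x Ax) _; rewrite lee_fin le_max lexx.
  rewrite integral_cst//; apply: lte_mul_pinfty => //.
  by rewrite lee_fin le_max lexx orbT.
split.
- apply: (integrable_mfrestr (moo := fA)).
  by have := integrable_fubini_F iF; rewrite /fubini_F (Fx id).
- apply/(measurable_restrictT _ mB).
  by have := measurable_fubini_G iF; rewrite /fubini_G (Fy id).
- by have := Fubini iF; rewrite (Fx id)// (Fy id)// !integral_mfrestr.
Qed.
End FubiniRestr.

(** * The mean of the potential over a pseudo-hyperbolic circle *)

Section MeanValue.
Context {R : realType} (Omega : set (plane R)) (c : R).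
Context (mO : measurable Omega) (c0 : 0 < c)
  (Oc : forall w, Omega w -> sqnorm w <= 1 - c).
Local Notation mu := (@hyp_measure R).
Local Notation leb := (@lebesgue_measure R).
Context (u : plane R -> R) (hu : L2 Omega u).
Implicit Types (z w : R * R) (r t : R).

Lemma open_disk : open (@disk R).
Proof.
have -> : @disk R = (@sqnorm R) @^-1` [set x | x < 1].
  by apply/seteqP; split=> w /= /diskE.
apply: open_comp; last exact: open_lt.
rewrite (_ : @sqnorm R = fun z => z.1 * z.1 + z.2 * z.2); last first.
  by apply/funext => z; rewrite /sqnorm !expr2.
by move=> z _; apply: cvgD; apply: cvgM; (exact: cvg_fst || exact: cvg_snd).
Qed.

Lemma potential_continuous z : disk z -> {for z, continuous (potential Omega u)}.
Proof.
move=> dz; apply/cvgrPdist_le => e e0.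
have [M M0 HM] := potential_dist mO c0 Oc hu.
(* This choice makes [M / n <= e / 2]; the summand 1 in [L] below keeps [L] positive when
   [M = 0]. *)
pose n := 1 + 2 * M / e.
have n1 : 1 <= n by rewrite /n lerDl divr_ge0 ?mulr_ge0// ltW.
have n0 : 0 < n by lra.
have Mn : M / n <= e / 2.
  rewrite ler_pdivrMr// /n mulrDr mulr1 -mulrA (_ : e / 2 * _ = M).
    by rewrite lerDr ltW// divr_gt0.
  by field; lra.
pose L := n * expR n * M + 1.
have L0 : 0 < L by rewrite /L; have := mulr_ge0 (mulr_ge0 (ltW n0) (expR_ge0 n)) M0; lra.
have d0 : 0 < e / 2 / L by rewrite !divr_gt0.
have nd : nbhs z (@disk R) by exact: open_nbhs_nbhs (conj open_disk dz).
have nb : nbhs z (ball z (e / 2 / L)) by exact: nbhsx_ballx.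
apply: filterS2 nd nb => y dy [y1 y2].
apply: le_trans (HM z y n dz dy n1) _.
have yd : `|z - y| <= e / 2 / L.
  by rewrite prod_normE ge_max; apply/andP; split; exact: ltW.
have : n * expR n * M * `|z - y| <= e / 2.
  apply: (@le_trans _ _ (L * `|z - y|)); first by rewrite ler_wpM2r// /L lerDl.
  by rewrite mulrC -ler_pdivlMr.
lra.
Qed.

Lemma ln_circle_ge0 (p q m n k s : R) : k ^+ 2 + s ^+ 2 = 1 ->
  0 <= p -> 0 <= q -> m ^+ 2 + n ^+ 2 = p * q ->
  0 <= p + q - 2 * (m * k - n * s).
Proof.
move=> ks p0 q0 mn.
have : (m * k - n * s) ^+ 2 <= p * q.
  rewrite -mn -subr_ge0 (_ : _ - _ = (m * s + n * k) ^+ 2) ?sqr_ge0//.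
  by rewrite -[m ^+ 2 + n ^+ 2]mulr1 -ks; ring.
set v := m * k - n * s => vpq; rewrite subr_ge0 leNgt; apply/negP => lt.
have : (p + q) ^+ 2 < (2 * v) ^+ 2.
  by rewrite ltr_sqr ?nnegrE ?addr_ge0// (le_trans _ (ltW lt))// addr_ge0.
by have := sqr_ge0 (p - q); nra.
Qed.

(** With [a = z - w], [b = 1 - conj(z) w] and [p = r e^it], [circ_num] is [|a - p b|^2] and
    [circ_den] is [|b - conj(p) a|^2]. *)
Let circ_num z r w t : R := num_sq z w + r ^+ 2 * den_sq z w -
  2 * (r * cross_re z w * cos t - r * cross_im z w * sin t).
Let circ_den z r w t : R := den_sq z w + r ^+ 2 * num_sq z w -
  2 * (r * cross_re z w * cos t - r * cross_im z w * sin t).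

Let cross_circ z r w :
  (r * cross_re z w) ^+ 2 + (r * cross_im z w) ^+ 2 = num_sq z w * (r ^+ 2 * den_sq z w).
Proof.
by rewrite !exprMn -mulrDr cross_sqr; ring.
Qed.

Let cross_circ' z r w :
  (r * cross_re z w) ^+ 2 + (r * cross_im z w) ^+ 2 = den_sq z w * (r ^+ 2 * num_sq z w).
Proof. by rewrite cross_circ; ring. Qed.

Let num_lt_den z r w : disk z -> disk w -> 0 <= r < 1 ->
  r ^+ 2 * num_sq z w < den_sq z w.
Proof.
move=> dz dw /andP[r0 r1]; apply: le_lt_trans (num_sq_lt_den_sq dz dw).
by rewrite ler_piMl ?num_sq_ge0// expr_le1// ltW.
Qed.

Let circ_den_gt0 z r w t : disk z -> disk w -> 0 <= r < 1 -> 0 < circ_den z r w t.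
Proof.
move=> dz dw r01; apply: ln_circle_gt0; last exact: cross_circ'.
- exact: cos2Dsin2.
- exact: den_sq_ge0.
- by rewrite mulr_ge0 ?num_sq_ge0// sqr_ge0.
- by rewrite gt_eqF// num_lt_den.
Qed.

Let circ_num_ge0 z r w t : 0 <= circ_num z r w t.
Proof.
apply: ln_circle_ge0; last exact: cross_circ.
- exact: cos2Dsin2.
- exact: num_sq_ge0.
- by rewrite mulr_ge0 ?den_sq_ge0// sqr_ge0.
Qed.

Let log_kernel_phi z r w t : disk z -> disk w -> 0 <= r < 1 ->
  log_kernel (phi z (polar r t)) w = - ln (circ_num z r w t / circ_den z r w t) / 2.
Proof.
move=> dz dw r01; rewrite /log_kernel pseudo_dist_phi_polar//.
have q0 : 0 <= circ_num z r w t / circ_den z r w t.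
  by rewrite divr_ge0// ltW// circ_den_gt0.
by rewrite ln_invr ?sqrtr_ge0// ln_sqrtr// mulNr.
Qed.

Let measurable_circ z r : disk z -> 0 <= r < 1 ->
  measurable_fun ([set` `[0, 2 * pi]] `*` Omega : set (measurableTypeR R * plane R))
    (fun tw => log_kernel (phi z (polar r tw.1)) tw.2 * u tw.2).
Proof.
move=> dz r01.
have mA : measurable ([set` `[0, 2 * pi]] `*` Omega : set (measurableTypeR R * plane R)).
  by apply: measurableX.
(* On this set the kernel is the logarithm of a quotient of polynomials in the coordinates, [cos t]
   and [sin t]; with [u] extended by 0, every factor is measurable on the whole product. *)
apply: (eq_measurable_fun (fun tw : measurableTypeR R * plane R =>
   - ln (circ_num z r tw.2 tw.1 * (powR (circ_den z r tw.2 tw.1) (- 1))) / 2 *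
   (u \_ Omega) tw.2)).
  move=> [t w]; rewrite inE => -[_ /= Ow].
  have dw := disk_hyp_bounded c0 Oc Ow.
  rewrite log_kernel_phi// powR_inv1 ?(ltW (circ_den_gt0 t dz dw r01))//.
  by rewrite patchE mem_set.
apply: measurable_funTS.
have m2 (h : plane R -> R) : measurable_fun setT h ->
    measurable_fun setT (fun tw : measurableTypeR R * plane R => h tw.2).
  by move=> mh; exact: measurableT_comp.
have m1 (h : R -> R) : continuous h ->
    measurable_fun setT (fun tw : measurableTypeR R * plane R => h tw.1).
  by move=> ch; apply: measurableT_comp => //; exact: continuous_measurable_fun.
have mcos := m1 cos (@continuous_cos R).
have msin := m1 sin (@continuous_sin R).
have mre : measurable_fun [set: plane R] (cross_re z).
  apply: measurable_funB; apply: measurable_funM; apply: measurable_funB => //.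
  - by apply: measurable_funD; apply: measurable_funM.
  - by apply: measurable_funM.
  - by apply: measurable_funM.
have mim : measurable_fun [set: plane R] (cross_im z).
  apply: measurable_funB; first apply: measurable_funN; apply: measurable_funM;
    apply: measurable_funB => //.
  - by apply: measurable_funM.
  - by apply: measurable_funM.
  - by apply: measurable_funD; apply: measurable_funM.
have mcr : measurable_fun setT (fun tw : measurableTypeR R * plane R =>
    2 * (r * cross_re z tw.2 * cos tw.1 - r * cross_im z tw.2 * sin tw.1)).
  apply: measurable_funM => //; apply: measurable_funB; apply: measurable_funM => //.
  - by apply: measurable_funM => //; exact: m2.
  - by apply: measurable_funM => //; exact: m2.
have mn := m2 _ (measurable_num_sq z).
have md := m2 _ (measurable_den_sq z).
apply: measurable_funM.
  apply: measurable_funM => //; apply: measurable_funN.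
  apply: measurableT_comp; first exact: measurable_ln.
  apply: measurable_funM.
    apply: measurable_funB => //; apply: measurable_funD => //.
    by apply: measurable_funM.
  apply: (measurableT_comp (measurable_powR (- 1))).
  apply: measurable_funB => //; apply: measurable_funD => //.
  by apply: measurable_funM.
by apply: m2; apply/(measurable_restrictT _ mO); case: hu.
Qed.
Let pseudo_dist_lt z r w : disk z -> disk w -> 0 <= r ->
  (pseudo_dist z w < r) = (num_sq z w < r ^+ 2 * den_sq z w).
Proof.
move=> dz dw r0; rewrite -[LHS]ltr_sqr ?nnegrE ?pseudo_dist_ge0//.
by rewrite pseudo_dist_sqr ltr_pdivrMr ?den_sq_gt0.
Qed.

Lemma measurable_pseudo_dist z : measurable_fun [set: plane R] (pseudo_dist z).
Proof.
rewrite (_ : pseudo_dist z = fun w => powR (num_sq z w * powR (den_sq z w) (- 1)) 2^-1).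
  apply: (measurableT_comp (measurable_powR 2^-1)).
  apply: measurable_funM; first exact: measurable_num_sq.
  exact: (measurableT_comp (measurable_powR (- 1)) (measurable_den_sq z)).
apply/funext => w; rewrite powR_inv1 ?den_sq_ge0// powR12_sqrt ?pseudo_distE//.
by rewrite divr_ge0 ?num_sq_ge0 ?den_sq_ge0.
Qed.

Lemma measurable_hyp_disk z r : disk z -> 0 <= r ->
  measurable (hyp_disk r z : set (plane R)).
Proof.
move=> dz r0.
rewrite (_ : hyp_disk r z =
  disk `&` (fun w => num_sq z w - r ^+ 2 * den_sq z w) @^-1` [set` `]-oo, 0[]).
  have md : measurable (disk : set (plane R)) by exact: measurable_disk.
  have H : measurable_fun [set: plane R] (fun w => num_sq z w - r ^+ 2 * den_sq z w).
    apply: measurable_funB; first exact: measurable_num_sq.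
    by apply: measurable_funM => //; exact: measurable_den_sq.
  by apply: measurableI => //; rewrite -[X in measurable X]setTI; exact: H.
apply/seteqP; split=> w /= [dw h]; split=> //; move: h;
  by rewrite in_itv/= subr_lt0 (pseudo_dist_lt dz dw r0).
Qed.

Let log_ratio z r w : R := ln (pseudo_dist z w / r) * u w.

(** For [0 < [z, w] < r < 1] one has [ln [z, w] <= ln ([z, w] / r) <= 0]; at [w = z] both logarithms
    are 0. *)
Lemma log_ratio_le z r w : disk z -> 0 < r < 1 -> Omega w -> hyp_disk r z w ->
  `|log_ratio z r w| <= `|log_kernel z w * u w|.
Proof.
move=> dz /andP[r0 r1] Ow [dw zr]; rewrite !normrM ler_wpM2r//.
have := pseudo_dist_ge0 z w; rewrite le_eqVlt => /predU1P[<-|p0].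
  by rewrite mul0r ln0// normr0.
have lr : ln r <= 0 by exact/ln_le0/ltW.
have : ln (pseudo_dist z w) <= ln r by rewrite ler_ln ?posrE// ltW.
rewrite /log_kernel ln_div ?posrE// lnV ?posrE// normrN => pr.
by rewrite !ler0_norm; lra.
Qed.

Lemma integrable_log_ratio z r : disk z -> 0 < r < 1 ->
  mu.-integrable (Omega `&` hyp_disk r z) (EFin \o log_ratio z r).
Proof.
move=> dz /[dup] r01 /andP[r0 r1].
have mD := measurable_hyp_disk dz (ltW r0).
have mI : measurable (Omega `&` (hyp_disk r z : set (plane R))) by exact: measurableI.
have mr : measurable_fun (Omega `&` (hyp_disk r z : set (plane R))) (log_ratio z r).
  apply: measurable_funM; last first.
    by apply: (measurable_funS mO); [exact: subIsetl|case: hu].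
  apply: measurable_funTS.
  apply: (@measurableT_comp _ _ _ _ _ _ (@ln R)); first exact: measurable_ln.
  by apply: measurable_funM => //; exact: measurable_pseudo_dist.
have sub : Omega `&` (hyp_disk r z : set (plane R)) `<=` Omega by exact: subIsetl.
apply: (le_integrable mI _ _ (integrableS mO mI sub (integrable_log_kernel_mul mO c0 Oc hu dz))).
- exact/measurable_EFinP.
- by move=> w [Ow Dw]; rewrite /= lee_fin log_ratio_le.
Qed.

(** With [N = num_sq z w] and [D = den_sq z w], Jensen's formula gives [ln (max N (r^2 D))] for the
    numerator and [ln D] for the denominator. The mean kernel is thus [- ln (max [z, w] r)], which
    inside [hyp_disk r z] is the kernel plus [ln ([z, w] / r)]. *)
Let circle_integral z r w : disk z -> 0 < r < 1 -> Omega w ->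
  num_sq z w != 0 -> num_sq z w != r ^+ 2 * den_sq z w ->
  (\int[leb]_(t in `[0%R, (2 * pi)%R]) (log_kernel (phi z (polar r t)) w * u w)%:E =
   (2 * pi * (log_kernel z w * u w + (log_ratio z r \_ (hyp_disk r z)) w))%:E)%E.
Proof.
move=> dz /andP[r0 r1] Ow n0 nr.
have r01 : 0 <= r < 1 by rewrite ltW.
have dw := disk_hyp_bounded c0 Oc Ow.
have N0 : 0 < num_sq z w by rewrite lt0r n0 num_sq_ge0.
have D0 := den_sq_gt0 dz dw.
have r2 : 0 < r ^+ 2 by rewrite exprn_gt0.
have rD0 : 0 < r ^+ 2 * den_sq z w by rewrite mulr_gt0.
have rN0 : 0 < r ^+ 2 * num_sq z w by rewrite mulr_gt0.
have nd : den_sq z w != r ^+ 2 * num_sq z w by rewrite gt_eqF// num_lt_den.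
have [iX IX] := integral_ln_circle (ltW N0) (ltW rD0) nr (cross_circ z r w).
have [iY IY] := integral_ln_circle (ltW D0) (ltW rN0) nd (cross_circ' z r w).
have kE t : (log_kernel (phi z (polar r t)) w * u w)%:E =
    ((- u w / 2)%:E * ((ln (circ_num z r w t))%:E - (ln (circ_den z r w t))%:E))%E.
  rewrite log_kernel_phi// ln_div ?posrE.
  - by rewrite -EFinB -EFinM; congr EFin; ring.
  - by apply: ln_circle_gt0 (cross_circ z r w); rewrite ?cos2Dsin2// ltW.
  - exact: circ_den_gt0.
under eq_integral do rewrite kE.
rewrite integralZl//; last by have := integrableB _ iX iY; exact.
rewrite integralB// [X in (_ * (X - _))%E]IX [X in (_ * (_ - X))%E]IY.
rewrite (max_l (ltW (num_lt_den dz dw r01))) -EFinB -EFinM; congr EFin.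
rewrite patchE /log_ratio /log_kernel ln_pseudo_distV.
have p0 : 0 < pseudo_dist z w by rewrite pseudo_distE sqrtr_gt0 divr_gt0.
have [rn|rn] := ltP (num_sq z w) (r ^+ 2 * den_sq z w).
- rewrite mem_set; last by split; rewrite ?pseudo_dist_lt// ltW.
  rewrite lnM ?posrE// lnXn// ln_div ?posrE// ln_div ?posrE//.
  rewrite pseudo_distE ln_sqrtr ?divr_ge0 ?(ltW N0) ?(ltW D0)// ln_div ?posrE//.
  by rewrite mulr2n; field.
- rewrite memNset; last by move=> [_]; rewrite pseudo_dist_lt// ?ltNge ?rn// ltW.
  (* Outside [hyp_disk r z] the restriction takes the default value [point], which is 0 in [R]. *)
  by rewrite (_ : point = 0)// ln_div ?posrE//; field.
Qed.

(** Fubini's theorem moves the circle mean onto the kernel, and [circle_integral] evaluates it for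
    almost every [w]. *)
Lemma mean_potential z r : disk z -> 0 < r < 1 ->
  leb.-integrable `[0, 2 * pi] (fun t => (potential Omega u (phi z (polar r t)))%:E) /\
  (\int[leb]_(t in `[0%R, (2 * pi)%R]) (potential Omega u (phi z (polar r t)))%:E =
   (2 * pi)%:E * ((potential Omega u z)%:E +
      \int[mu]_(w in Omega `&` hyp_disk r z) (ln (pseudo_dist z w / r) * u w)%:E))%E.
Proof.
move=> dz /[dup] r01 /andP[r0 r1].
have r01' : 0 <= r < 1 by rewrite ltW.
have dphi t : disk (phi z (polar r t)) by exact/disk_phi/disk_polar.
have [M HM] := integral_log_kernel_mul_bound mO c0 Oc hu.
have l2pi : (leb [set` `[0%R, (2 * pi)%R : R]] < +oo)%E.
  by rewrite lebesgue_measure_0_2pi ltry.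
have mI0 : measurable ([set` `[0%R, (2 * pi)%R : R]] : set (measurableTypeR R)).
  exact: measurable_itv.
have [i1 m2 E] := @Fubini_restr _ _ (measurableTypeR R) (plane R) R leb mu _ _ mI0 mO l2pi
  (hyp_measure_lty mO c0 Oc) _ M (measurable_circ dz r01') (fun t _ => HM _ (dphi t)).
have PE t : (\int[mu]_(w in Omega) (log_kernel (phi z (polar r t)) w * u w)%:E)%E =
    (potential Omega u (phi z (polar r t)))%:E.
  exact: (potentialE mO c0 Oc hu (dphi t)).
split.
  have <- : (fun t => \int[mu]_(w in Omega) (log_kernel (phi z (polar r t)) w * u w)%:E)%E =
    (fun t => (potential Omega u (phi z (polar r t)))%:E) by apply/funext => t; exact: PE.
  exact: i1.
transitivity (\int[leb]_(t in `[0%R, (2 * pi)%R])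
    \int[mu]_(w in Omega) (log_kernel (phi z (polar r t)) w * u w)%:E)%E.
  by apply: eq_integral => t _; rewrite PE.
apply: (eq_trans E).
have mD := measurable_hyp_disk dz (ltW r0).
have mI : measurable (Omega `&` (hyp_disk r z : set (plane R))) by exact: measurableI.
have ik := integrable_log_kernel_mul mO c0 Oc hu dz.
have ir : mu.-integrable Omega (EFin \o (log_ratio z r \_ (hyp_disk r z))).
  apply/(integrable_mkcond _ mO).
  have /(integrable_mkcond _ mI) := integrable_log_ratio dz r01.
  congr (integrable _ _ _); apply/funext => w.
  rewrite !patchE in_setI; case: (w \in Omega) => //=.
  by rewrite patchE; case: ifP.
(* [N] is the union of [{z}] and of the pseudo-circle of radius [r] about [z]. *)
pose N : set (plane R) := [set w | num_sq z w = 0 ^+ 2 * den_sq z w] `|`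
  [set w | num_sq z w = r ^+ 2 * den_sq z w].
have mN : measurable N by apply: measurableU; exact: measurable_pseudo_circle.
have N0 : mu N = 0%E.
  apply/measure_negligible => //; apply: negligibleU; apply/negligibleP.
  - exact: measurable_pseudo_circle.
  - by apply: (hyp_measure_pseudo_circle dz); rewrite lexx ltr01.
  - exact: measurable_pseudo_circle.
  - exact: (hyp_measure_pseudo_circle dz r01').
transitivity (\int[mu]_(w in Omega)
   ((2 * pi)%:E * ((log_kernel z w * u w)%:E + (EFin \o (log_ratio z r \_ (hyp_disk r z))) w)))%E.
  apply: ae_eq_integral => //.
  - apply: emeasurable_funM => //; apply: emeasurable_funD.
      by have /integrableP[] := ik.
    by have /integrableP[] := ir.
  - exists N; split=> // w /= /not_implyP[Ow] ne.
    apply: contrapT => Nw; apply: ne.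
    have [n1 n2] : num_sq z w != 0 /\ num_sq z w != r ^+ 2 * den_sq z w.
      split; apply/eqP => e; apply: Nw; [left|right] => //=.
      by rewrite e expr0n mul0r.
    by rewrite (circle_integral dz r01 Ow n1 n2) -EFinD -EFinM.
rewrite integralZl//; last by have := integrableD mO ik ir; exact.
rewrite integralD// (potentialE mO c0 Oc hu dz); congr (_ * (_ + _))%E.
rewrite [RHS]integral_mkcondr; apply: eq_integral => w _ /=.
by rewrite !patchE; case: ifPn.
Qed.
End MeanValue.

(** * Hyperbolically bounded sets and the two cases of the eigenvalue *)

Section HyperbolicallyBounded.
Context {R : realType}.
Implicit Types (z w : R * R) (r t : R).

Lemma num_sqC z w : num_sq z w = num_sq w z.
Proof. by rewrite /num_sq; ring. Qed.

Lemma den_sqC z w : den_sq z w = den_sq w z.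
Proof. by rewrite /den_sq; ring. Qed.

(** Fix [w0] in [Omega] and let [p = [w0, w]]. The bound [M] gives [1 - p >= e^-M = d]. In
    [(1 - p^2) D = b (1 - |w|^2)], where [D = den_sq w0 w], the lower bound [D >= (b / 2)^2] then
    yields [1 - |w|^2 >= d b / 4]. *)
Lemma hyp_bounded_sqnorm (Omega : set (R * R)) : Omega `<=` disk ->
  hyp_bounded Omega ->
  exists2 c : R, 0 < c & forall w, Omega w -> sqnorm w <= 1 - c.
Proof.
move=> Od [M HM].
have [[w0 Ow0]|O0] := pselect (exists w, Omega w); last first.
  by exists 1 => // w Ow; exfalso; apply: O0; exists w.
have dw0 := Od _ Ow0; move/diskE : (dw0) => w01.
set d := expR (- M); set b := 1 - sqnorm w0.
have d0 : 0 < d by exact: expR_gt0.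
have b0 : 0 < b by rewrite subr_gt0.
exists (d * b / 4); first by rewrite divr_gt0// mulr_gt0.
move=> w Ow; have dw := Od _ Ow.
have p0 := pseudo_dist_ge0 w0 w; have p1 := pseudo_dist_lt1 dw0 dw.
have := HM _ _ Ow0 Ow; rewrite /hyp_dist /artanh mulrC divfK//.
set p := pseudo_dist w0 w in p0 p1 * => lnM.
have pd : d <= 1 - p.
  have q0 : 0 < (1 + p) / (1 - p) by rewrite divr_gt0//; lra.
  have : (1 + p) / (1 - p) <= expR M by rewrite -(lnK q0) ler_expR.
  rewrite ler_pdivrMr; last by lra.
  move=> h; rewrite /d expRN -div1r ler_pdivrMr ?expR_gt0// mulrC.
  by apply: le_trans h; lra.
have D0 := den_sq_gt0 dw0 dw.
have pE : (1 - p ^+ 2) * den_sq w0 w = b * (1 - sqnorm w).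
  by rewrite /p pseudo_dist_sqr mulrBl mul1r divfK ?gt_eqF// den_sq_num_sq /b; ring.
have Dlb : (b / 2) ^+ 2 <= den_sq w0 w.
  by rewrite den_sqC; apply: den_sq_lb => //; [exact: ltW|rewrite /b; lra].
have dp : d <= 1 - p ^+ 2 by nra.
have : d * (b / 2) ^+ 2 <= b * (1 - sqnorm w).
  by rewrite -pE ler_pM// ?sqr_ge0// ltW.
rewrite (_ : d * _ = b * (d * b / 4)); last by field.
by rewrite ler_pM2l//; lra.
Qed.

(** By symmetry, this is [pseudo_dist_phi_polar] at [w = z], where [a = z - w] vanishes. *)
Lemma pseudo_dist_phi z r t : disk z -> 0 <= r < 1 ->
  pseudo_dist z (phi z (polar r t)) = r.
Proof.
move=> dz /[dup] r01 /andP[r0 r1].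
have -> : pseudo_dist z (phi z (polar r t)) = pseudo_dist (phi z (polar r t)) z.
  by rewrite !pseudo_distE num_sqC den_sqC.
rewrite pseudo_dist_phi_polar//.
have -> : num_sq z z = 0 by rewrite /num_sq; ring.
have -> : cross_re z z = 0 by rewrite /cross_re; ring.
have -> : cross_im z z = 0 by rewrite /cross_im; ring.
rewrite !mulr0 !mul0r subrr mulr0 !subr0 add0r addr0 mulfK ?gt_eqF ?den_sq_gt0//.
by rewrite sqrtr_sqr ger0_norm.
Qed.

Lemma continuous_quadratic (a b k : R) (f : R -> R) :
  (forall s, f s = a + b * s + k * (s * s)) -> continuous f.
Proof.
move=> fE; rewrite (funext fE) => s; apply: cvgD; last by apply: cvgMr; exact: cvgM.
by apply: cvgD; [exact: cvg_cst|apply: cvgMr; exact: cvg_id].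
Qed.

(** Along a ray the coordinates are quotients of quadratic polynomials in [s]. That formula is
    available for [0 <= s < 1], hence the passage through an equality near [r]. *)
Lemma continuous_phi_polar z r t : disk z -> 0 < r < 1 ->
  {for r, continuous (fun s => phi z (polar s t))}.
Proof.
move=> dz /andP[r0 r1].
pose f s := (cross_re z (polar s t) / den_sq z (polar s t),
             - cross_im z (polar s t) / den_sq z (polar s t)).
pose q := z.1 * cos t + z.2 * sin t; pose d := z.1 * sin t - z.2 * cos t.
have cre : {for r, continuous (fun s => cross_re z (polar s t))}.
  apply: (@continuous_quadratic z.1 (- (cos t + z.1 * q + z.2 * d))
    (cos t * q + sin t * d)) => s.
  by rewrite /cross_re /polar /q /d /=; ring.
have cim : {for r, continuous (fun s => cross_im z (polar s t))}.
  apply: (@continuous_quadratic (- z.2) (- z.1 * d + sin t + z.2 * q)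
    (cos t * d - sin t * q)) => s.
  by rewrite /cross_im /polar /q /d /=; ring.
have cde : {for r, continuous (fun s => den_sq z (polar s t))}.
  apply: (@continuous_quadratic 1 (- (2 * q)) (q ^+ 2 + d ^+ 2)) => s.
  by rewrite /den_sq /polar /q /d /=; ring.
have {}cde : {for r, continuous (fun s => (den_sq z (polar s t))^-1)}.
  apply: (cvgV _ cde).
  by rewrite gt_eqF// den_sq_gt0//; apply: disk_polar; rewrite ltW.
have cf : {for r, continuous f}.
  exact: (cvg_pair (cvgM cre cde) (cvgM (cvgN cim) cde)).
have E : \forall s \near r, f s = phi z (polar s t).
  have : nbhs r [set` `]0%R, 1%R[] by apply: near_in_itvoo; rewrite in_itv/= r0.
  apply: filterS => s; rewrite /= in_itv /= => /andP[s0 s1].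
  by rewrite /f phiE//; apply: disk_polar; rewrite ltW.
rewrite /prop_for /continuous_at -(nbhs_singleton E).
exact: cvg_trans (near_eq_cvg E) cf.
Qed.

Lemma log_potential_potential (Omega : set (plane R)) c (u : plane R -> R) z :
  measurable Omega -> 0 < c -> (forall w, Omega w -> sqnorm w <= 1 - c) ->
  L2 Omega u -> disk z ->
  log_potential Omega u z = (2^-1 * potential Omega u z)%:E.
Proof.
move=> mO c0 Oc hu dz; rewrite EFinM -(potentialE mO c0 Oc hu dz).
by [].
Qed.

Lemma mean_value_formula_neq0 (Omega : set (plane R)) c (u : plane R -> R) tau z r :
  measurable Omega -> 0 < c -> (forall w, Omega w -> sqnorm w <= 1 - c) ->
  L2 Omega u -> tau != 0 ->
  (forall y, disk y -> (tau * u y)%:E = log_potential Omega u y) ->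
  disk z -> 0 < r < 1 -> mean_value_formula Omega tau u z r.
Proof.
move=> mO c0 Oc hu tau0 uE dz /[dup] r01 /andP[r0 r1].
have r01' : 0 <= r < 1 by rewrite ltW.
have upot y : disk y -> u y = (2 * tau)^-1 * potential Omega u y.
  move=> dy; have := uE y dy; rewrite (log_potential_potential mO c0 Oc hu dy) => -[tE].
  by apply: (mulfI tau0); rewrite tE; field.
have dphi t : disk (phi z (polar r t)) by exact/disk_phi/disk_polar.
have [ip Ep] := mean_potential mO c0 Oc hu dz r01.
have mI : measurable (Omega `&` (hyp_disk r z : set (plane R))).
  by apply: measurableI => //; exact: (measurable_hyp_disk dz (ltW r0)).
have ir := integrable_log_ratio mO c0 Oc hu dz r01.
have fr := integrable_fin_num mI ir.
rewrite /mean_value_formula.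
rewrite -[X in (_ - _ * X)%E](fineK fr) -[X in (_ - _ * X)%E]/(_%:E).
set j := fine _.
(* With [P] the potential at [z], the right-hand side is
   [(P + j) / 2 - j / 2 = P / 2 = tau u(z)]. *)
transitivity (((tau / (2 * pi))%:E * ((2 * tau)^-1%:E *
   ((2 * pi)%:E * ((potential Omega u z)%:E + j%:E))) - 2^-1%:E * j%:E))%E.
  rewrite -!(EFinM, EFinD, EFinN); congr EFin; rewrite upot//.
  have pi0 : pi != 0 :> R by rewrite gt_eqF ?pi_gt0.
  by move: pi0; generalize (pi : R) => p p0; field; rewrite tau0 p0.
congr (_ * _ - _)%E.
transitivity ((2 * tau)^-1%:E * \int[lebesgue_measure]_(t in `[0%R, (2 * pi)%R])
   (potential Omega u (phi z (polar r t)))%:E)%E.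
  by rewrite Ep; congr (_ * (_ * (_ + _)))%E; exact: (fineK fr).
rewrite -integralZl//; apply: eq_integral => t _.
by rewrite -EFinM -upot.
Qed.

Lemma continuous_eigenfunction (Omega : set (plane R)) c (u : plane R -> R) tau :
  measurable Omega -> 0 < c -> (forall w, Omega w -> sqnorm w <= 1 - c) ->
  L2 Omega u -> tau != 0 ->
  (forall y, disk y -> (tau * u y)%:E = log_potential Omega u y) ->
  {within disk, continuous (u : R * R -> R)}.
Proof.
move=> mO c0 Oc hu tau0 uE.
apply: (@subspace_eq_continuous _ _ _ (fun y => (2 * tau)^-1 * potential Omega u y)).
  move=> y; rewrite inE => dy.
  have := uE y dy; rewrite (log_potential_potential mO c0 Oc hu dy) => -[tE].
  by apply: (mulfI tau0); rewrite tE; field.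
rewrite continuous_open_subspace; last exact: open_disk.
move=> y; rewrite inE => dy; apply: cvgM; first exact: cvg_cst.
exact: (potential_continuous mO c0 Oc hu dy).
Qed.

(** If the potential were nonzero at [z], it would be nonzero on a ball in [Omega]. The exceptional
    null set would contain this ball, whose measure is positive. *)
Lemma potential_eigenfunction0 (Omega : set (R * R)) c (u : plane R -> R) z :
  open Omega -> 0 < c -> (forall w, Omega w -> sqnorm w <= 1 - c) ->
  eigenfunction Omega 0 u -> Omega z -> potential Omega u z = 0.
Proof.
move=> oO c0 Oc [hu _ ae] Oz.
have mO := open_measurable_plane oO.
have dz := disk_hyp_bounded c0 Oc Oz.
apply/eqP; apply: contrapT => /negP pz.
have cz := potential_continuous mO c0 Oc hu dz.
have : nbhs z [set y | potential Omega u y != 0].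
  apply: (cz [set x | x != 0]); apply: open_nbhs_nbhs; split => //; exact: open_neq.
have nO : nbhs z Omega by exact: open_nbhs_nbhs.
move=> /(filterI nO)/nbhs_ballP[e /= e0 eO].
case: ae => N [mN N0 sub].
have mB := @measurable_ball_prod R z e.
have BN : ball z e `<=` N.
  move=> y /eO[Oy py]; apply: sub => /= /(_ Oy).
  have dy := disk_hyp_bounded c0 Oc Oy.
  rewrite (log_potential_potential mO c0 Oc hu dy) mul0r => -[] /eqP.
  by rewrite mulf_eq0 invr_eq0 pnatr_eq0 /= => p0; move: py; rewrite /= p0.
have Bd : ball z e `<=` disk by move=> y /eO[Oy _]; exact: (disk_hyp_bounded c0 Oc Oy).
have := le_trans (hyp_measure_ge mB Bd) (le_measure hyp_measure (mem_set mB) (mem_set mN) BN).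
rewrite [X in (_ <= X)%E]N0 (area_ball z (ltW e0)) -EFinM lee_fin leNgt => /negP; apply.
by rewrite mulr_gt0 ?invr_gt0 ?pi_gt0// mulr_gt0// mulrn_wgt0.
Qed.

Lemma mean_value_formula_eq0 (Omega : set (R * R)) c (u : plane R -> R) z r :
  open Omega -> 0 < c -> (forall w, Omega w -> sqnorm w <= 1 - c) ->
  eigenfunction Omega 0 u -> Omega z -> 0 < r -> hyp_disk r z `<=` Omega ->
  mean_value_formula Omega 0 u z r.
Proof.
move=> oO c0 Oc eu Oz r0 DO.
have mO := open_measurable_plane oO.
have dz := disk_hyp_bounded c0 Oc Oz.
have hu : L2 Omega u by case: eu.
have c1 : c <= 1 by have := Oc _ Oz; have := sqnorm_ge0 z; lra.
(* For [r >= 1] the set [hyp_disk r z] is the whole disk, which contains a point with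
   [|w|^2 = 1 - c / 2 > 1 - c], outside [Omega]. *)
have r1 : r < 1.
  rewrite ltNge; apply/negP => r1.
  pose w : R * R := (Num.sqrt (1 - c / 2), 0).
  have w2 : sqnorm w = 1 - c / 2 by rewrite /sqnorm /= expr0n addr0 sqr_sqrtr//; lra.
  have dw : disk w by apply/diskE; rewrite w2; lra.
  have /Oc : Omega w.
    by apply: DO; split=> //; exact: lt_le_trans (pseudo_dist_lt1 dz dw) r1.
  by rewrite w2; lra.
have r01 : 0 < r < 1 by rewrite r0.
have r01' : 0 <= r < 1 by rewrite ltW.
have p0 := potential_eigenfunction0 oO c0 Oc eu.
(* The bounding circle may leave [Omega], but the circles of radius [s < r] lie in [hyp_disk r z];
   let [s] tend to [r] along a ray. *)
have pc t : potential Omega u (phi z (polar r t)) = 0.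
  have dp : disk (phi z (polar r t)) by exact/disk_phi/disk_polar.
  have cp : {for r, continuous (fun s => potential Omega u (phi z (polar s t)))}.
    apply: (@continuous_comp _ _ _ (fun s => phi z (polar s t)) (potential Omega u)).
      exact: continuous_phi_polar.
    exact: (potential_continuous mO c0 Oc hu dp).
  apply/eqP; apply: contrapT => /negP pn.
  have : nbhs r [set s | potential Omega u (phi z (polar s t)) != 0].
    by apply: (cp [set x | x != 0]); apply: open_nbhs_nbhs; split => //; exact: open_neq.
  move=> /nbhs_ballP[e /= e0 re].
  (* The maximum keeps the radius nonnegative when [e] is large. *)
  pose s := Num.max (r - e / 2) 0.
  have s0 : 0 <= s by rewrite /s le_max lexx orbT.
  have sr : s < r by rewrite /s gt_max r0 andbT; lra.
  have s01 : 0 <= s < 1 by rewrite s0 (lt_trans sr).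
  have /re /= : ball r e s.
    rewrite /ball /= ger0_norm; last by rewrite subr_ge0 ltW.
    have : r - e / 2 <= s by rewrite /s le_max lexx.
    by lra.
  rewrite p0 ?eqxx//; apply: DO; split; first exact/disk_phi/disk_polar.
  by rewrite pseudo_dist_phi.
have [ip] := mean_potential mO c0 Oc hu dz r01.
(* Now [mean_potential] reads [0 = 2 pi J], with [J] the integral over [hyp_disk r z]. *)
rewrite (p0 _ Oz) add0e (eq_integral (cst 0%E)); last by move=> t _; rewrite pc.
rewrite integral0 => /esym/eqP; rewrite mule_eq0 eqe.
rewrite mulf_eq0 pnatr_eq0 (gt_eqF (pi_gt0 R)) /= => /eqP J0.
by rewrite /mean_value_formula J0 !mul0r mul0e mule0 sube0.
Qed.

End HyperbolicallyBounded.

Theorem theorem1p3 (R : realType) (Omega : set (R * R))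
    (Omega_open : open Omega) (Omega_disk : Omega `<=` disk)
    (Omega_bounded : hyp_bounded Omega) :
  (forall (tau : R) (u : R * R -> R),
     tau != 0 ->
     eigenfunction Omega tau u ->
     (forall z, disk z -> (tau * u z)%:E = log_potential Omega u z) ->
     {within disk, continuous u} /\
     (forall (z : R * R) (r : R), disk z -> 0 < r < 1 - cabs z ->
        mean_value_formula Omega tau u z r)) /\
  (forall u : R * R -> R,
     eigenfunction Omega 0 u ->
     forall (z : R * R) (r : R), Omega z -> 0 < r ->
       hyp_disk r z `<=` Omega ->
       mean_value_formula Omega 0 u z r).
Proof.
have [c c0 Oc] := hyp_bounded_sqnorm Omega_disk Omega_bounded.
have mO := open_measurable_plane Omega_open.
split=> [tau u tau0 [hu _ _] uE|u eu z r Oz r0 DO]; last first.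
  exact: (mean_value_formula_eq0 Omega_open c0 Oc eu Oz r0 DO).
split=> [|z r dz /andP[r0 r1]].
  exact: (continuous_eigenfunction mO c0 Oc hu tau0 uE).
apply: (mean_value_formula_neq0 mO c0 Oc hu tau0 uE dz).
by rewrite r0 (lt_le_trans r1)// lerBlDr lerDl cabsE sqrtr_ge0.
Qed.
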